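(* For every $d>0$ there exist constants $\alpha,\alpha'>0$ depending only on $d$ such that for every $q\in(0,1/2)$ and every integer $L\in[1,d/q]$, with $n=\lceil\log_2L\rceil$, $$\frac{n!}{q^n2^{\binom n2}}\,q^{\alpha}\le T_{\rm rel}(L)\le\frac{n!}{q^n2^{\binom n2}}\,q^{-\alpha'}.$$
   Context: Fix $q\in(0,1/2)$, $p=1-q$. For an integer $L\ge1$ let $\Lambda=\{1,\dots,L\}$, $\Omega_\Lambda=\{0,1\}^\Lambda$, and $\pi$ the product measure with $\pi(\sigma_x=1)=p$, $\pi(\sigma_x=0)=q$. The East process on $\Lambda$ has generator $\mathcal L_\Lambda f(\sigma)=\sum_{x\in\Lambda}c_x(\sigma)[\pi_x(f)-f](\sigma)$ with $c_1\equiv1$, $c_x(\sigma)=1-\sigma_{x-1}$ for $x\ge2$, where $\pi_x(f)$ averages $f$ over $\sigma_x\sim$ Bernoulli$(p)$. Its Dirichlet form is $\mathcal D_\Lambda(f)=\sum_x\pi(c_x\mathrm{Var}_x(f))$, and $T_{\rm rel}(L)$ is the inverse of the spectral gap $\inf_{f\text{ non-constant}}\mathcal D_\Lambda(f)/\mathrm{Var}_\pi(f)$. *)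

(* Defs.v *)
From Stdlib Require Import Reals List Arith.
Import ListNotations.
Open Scope R_scope.

(* Configurations sigma in {0,1}^L are lists of booleans of length L;
   site x in {1..L} is stored at list index x-1; true means sigma_x = 1. *)
Fixpoint configs (L : nat) : list (list bool) :=
  match L with
  | O => [ [] ]
  | S n => flat_map (fun s => [true :: s; false :: s]) (configs n)
  end.

Definition sumL {A : Type} (g : A -> R) (l : list A) : R :=
  fold_right (fun (a : A) (acc : R) => g a + acc) 0 l.

Definition pi_conf (q : R) (s : list bool) : R :=
  fold_right (fun (b : bool) (acc : R) => (if b then 1 - q else q) * acc) 1 s.

Definition Epi (q : R) (L : nat) (f : list bool -> R) : R :=
  sumL (fun s => pi_conf q s * f s) (configs L).

Definition Varpi (q : R) (L : nat) (f : list bool -> R) : R :=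
  Epi q L (fun s => f s * f s) - Epi q L f * Epi q L f.

Fixpoint upd (i : nat) (b : bool) (s : list bool) : list bool :=
  match s, i with
  | [], _ => []
  | _ :: t, O => b :: t
  | a :: t, S j => a :: upd j b t
  end.

(* pi_x(f), x given as 0-based index i (site i+1) *)
Definition pix (q : R) (i : nat) (f : list bool -> R) (s : list bool) : R :=
  (1 - q) * f (upd i true s) + q * f (upd i false s).

Definition Varx (q : R) (i : nat) (f : list bool -> R) (s : list bool) : R :=
  pix q i (fun t => f t * f t) s - pix q i f s * pix q i f s.

(* East constraint: c_1 = 1, c_x = 1 - sigma_{x-1}; 0-based index i *)
Definition cEast (i : nat) (s : list bool) : R :=
  match i with
  | O => 1
  | S j => if nth j s false then 0 else 1
  end.

Definition Dirichlet (q : R) (L : nat) (f : list bool -> R) : R :=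
  sumL (fun i => Epi q L (fun s => cEast i s * Varx q i f s)) (seq 0 L).

Definition nonconstant (L : nat) (f : list bool -> R) : Prop :=
  exists s1 s2, In s1 (configs L) /\ In s2 (configs L) /\ f s1 <> f s2.

Definition is_spectral_gap (q : R) (L : nat) (g : R) : Prop :=
  (forall f, nonconstant L f -> g <= Dirichlet q L f / Varpi q L f) /\
  (forall g', (forall f, nonconstant L f -> g' <= Dirichlet q L f / Varpi q L f) -> g' <= g).

Definition choose2 (n : nat) : nat := (n * (n - 1)) / 2.

Definition east_scale (q : R) (n : nat) : R :=
  INR (fact n) / (q ^ n * 2 ^ (choose2 n)).

(* Main.v *)
Require Import Defs.
From Stdlib Require Import Reals List Arith Lra Lia.
Import ListNotations.
Open Scope R_scope.

(** Upper bound on the relaxation time. Split a chain into a left block of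
    length [M] and a right block, and let the right block be resampled only when
    the last [D] sites of the left one contain a zero, an event of probability of
    order [q D]. Since the sites to the right of the leftmost such zero form a
    free East chain, the Poincaré constant of length [2 M + 1 - D] is at most
    [C / (q D)] times that of length [M]. Taking [D] of order [M / n] in each of
    [n] doublings loses a constant factor in the final length and gives
    [C^n n^n / (q^n 2^(n choose 2))].

    Lower bound. Let the zeros die one after the other, a zero at distance [j]
    from the nearest surviving zero on its left dying at time [j], and take as
    test function the indicator that some zero lives at least [2^kappa], of order
    [1 / q]. If a legal flip at [x] changes it, the interval [x - 1, x] can be
    enlarged to length [2^kappa] by moving one endpoint at a time to a zero, the
    length at most doubling at each step. To reach [2^kappa] in about [kappa]
    steps almost no length may be lost, and this constraint on the steps cuts the
    number of such chains from [2^(kappa^2 / 2)] down by a factor [kappa!]; the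
    expected number is bounded by an explicit supersolution of the recursion over
    the length. Constants to the power [n] and powers of [L] are at most powers of
    [1 / q]. *)

(** * Expectations *)

Lemma sumL_plus {A} (f g : A -> R) l :
  sumL (fun a => f a + g a) l = sumL f l + sumL g l.
Proof. induction l as [|a l IH]; simpl; [lra | rewrite IH; lra]. Qed.

Lemma sumL_scal {A} (c : R) (f : A -> R) l : sumL (fun a => c * f a) l = c * sumL f l.
Proof. induction l as [|a l IH]; simpl; [lra | rewrite IH; lra]. Qed.

Lemma sumL_ext {A} (f g : A -> R) l : (forall a, In a l -> f a = g a) -> sumL f l = sumL g l.
Proof.
  intros H; induction l as [|a l IH]; simpl; [reflexivity|].
  rewrite H, IH; [reflexivity | intros; apply H; now right | now left].
Qed.

Lemma sumL_le {A} (f g : A -> R) l : (forall a, In a l -> f a <= g a) -> sumL f l <= sumL g l.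
Proof.
  intros H; induction l as [|a l IH]; simpl; [lra|].
  apply Rplus_le_compat; [apply H; now left | apply IH; intros; apply H; now right].
Qed.

Lemma sumL_const {A} (c : R) (l : list A) : sumL (fun _ => c) l = INR (length l) * c.
Proof.
  induction l as [|a l IH]; [simpl; lra|].
  change (c + sumL (fun _ => c) l = INR (S (length l)) * c).
  rewrite IH, S_INR; lra.
Qed.

Lemma sumL_nonneg {A} (f : A -> R) l : (forall a, In a l -> 0 <= f a) -> 0 <= sumL f l.
Proof.
  intros H; rewrite <- (Rmult_0_r (INR (length l))), <- sumL_const; now apply sumL_le.
Qed.

Lemma sumL_map {A B} (f : B -> R) (h : A -> B) l : sumL f (map h l) = sumL (fun a => f (h a)) l.
Proof. induction l as [|a l IH]; simpl; [reflexivity | now rewrite IH]. Qed.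

Lemma sumL_ge_term {A} (f : A -> R) l a :
  (forall b, In b l -> 0 <= f b) -> In a l -> f a <= sumL f l.
Proof.
  intros Hf; induction l as [|b l IH]; simpl; [easy|].
  intros [-> | Ha].
  - assert (0 <= sumL f l) by (apply sumL_nonneg; intros; apply Hf; now right). lra.
  - assert (f a <= sumL f l) by (apply IH; [intros; apply Hf; now right | easy]).
    assert (0 <= f b) by (apply Hf; now left). lra.
Qed.

Lemma In_configs n s : In s (configs n) <-> length s = n.
Proof.
  revert s; induction n as [|n IH]; simpl; intros s.
  - destruct s; simpl; intuition discriminate.
  - rewrite in_flat_map; split.
    + intros (t & Ht & Hs); apply IH in Ht.
      destruct Hs as [<- | [<- | []]]; simpl; now rewrite Ht.
    + destruct s as [|b t]; simpl; [discriminate|].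
      intros [= Ht]; exists t; split; [now apply IH|].
      destruct b; simpl; tauto.
Qed.

Lemma Epi_0 q f : Epi q 0 f = f [].
Proof. unfold Epi; simpl; lra. Qed.

Lemma Epi_S q n f :
  Epi q (S n) f = (1 - q) * Epi q n (fun s => f (true :: s)) + q * Epi q n (fun s => f (false :: s)).
Proof.
  unfold Epi; simpl.
  induction (configs n) as [|s l IH]; simpl; [lra|].
  rewrite IH; lra.
Qed.

Lemma Epi_ext q n f g : (forall s, length s = n -> f s = g s) -> Epi q n f = Epi q n g.
Proof.
  intros H; apply sumL_ext; intros s Hs; apply In_configs in Hs; now rewrite H.
Qed.

Lemma Epi_plus q n f g : Epi q n (fun s => f s + g s) = Epi q n f + Epi q n g.
Proof. unfold Epi; rewrite <- sumL_plus; apply sumL_ext; intros; lra. Qed.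

Lemma Epi_scal q n c f : Epi q n (fun s => c * f s) = c * Epi q n f.
Proof. unfold Epi; rewrite <- sumL_scal; apply sumL_ext; intros; lra. Qed.

Lemma Epi_minus q n f g : Epi q n (fun s => f s - g s) = Epi q n f - Epi q n g.
Proof.
  replace (Epi q n f - Epi q n g) with (Epi q n f + (-1) * Epi q n g) by lra.
  rewrite <- Epi_scal, <- Epi_plus; apply Epi_ext; intros; lra.
Qed.

Lemma Epi_const q n c : Epi q n (fun _ => c) = c.
Proof. induction n as [|n IH]; [apply Epi_0 | rewrite Epi_S, IH; lra]. Qed.

Lemma Epi_sumL {A} q n (F : A -> list bool -> R) l :
  Epi q n (fun s => sumL (fun a => F a s) l) = sumL (fun a => Epi q n (F a)) l.
Proof.
  induction l as [|a l IH]; simpl; [apply Epi_const|].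
  now rewrite Epi_plus, IH.
Qed.

Lemma Epi_app q m n f :
  Epi q (m + n) f = Epi q m (fun a => Epi q n (fun b => f (a ++ b))).
Proof.
  revert f; induction m as [|m IH]; simpl; intros f; [now rewrite Epi_0|].
  now rewrite !Epi_S, !IH.
Qed.

Lemma Epi_swap q m n (F : list bool -> list bool -> R) :
  Epi q m (fun a => Epi q n (fun b => F a b)) = Epi q n (fun b => Epi q m (fun a => F a b)).
Proof.
  revert F; induction m as [|m IH]; intros F.
  - rewrite Epi_0; apply Epi_ext; intros; now rewrite Epi_0.
  - rewrite Epi_S, (IH (fun a b => F (true :: a) b)), (IH (fun a b => F (false :: a) b)).
    rewrite <- !Epi_scal, <- Epi_plus.
    apply Epi_ext; intros; now rewrite Epi_S.
Qed.

Section Measure.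
Variable q : R.
Hypothesis q_pos : 0 < q.
Hypothesis q_lt1 : q < 1.

Lemma pi_conf_pos s : 0 < pi_conf q s.
Proof.
  induction s as [|b s IH]; simpl; [lra|].
  apply Rmult_lt_0_compat; [destruct b; lra | exact IH].
Qed.

Lemma Epi_le n f g : (forall s, length s = n -> f s <= g s) -> Epi q n f <= Epi q n g.
Proof.
  intros H; apply sumL_le; intros s Hs; apply In_configs in Hs.
  apply Rmult_le_compat_l; [apply Rlt_le, pi_conf_pos | now apply H].
Qed.

Lemma Epi_nonneg n f : (forall s, length s = n -> 0 <= f s) -> 0 <= Epi q n f.
Proof. intros H; rewrite <- (Epi_const q n 0); now apply Epi_le. Qed.

Lemma Epi_ge_atom n f s :
  (forall t, length t = n -> 0 <= f t) -> length s = n -> pi_conf q s * f s <= Epi q n f.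
Proof.
  intros Hf Hs; unfold Epi.
  apply (sumL_ge_term (fun s => pi_conf q s * f s)).
  - intros t Ht; apply In_configs in Ht.
    apply Rmult_le_pos; [apply Rlt_le, pi_conf_pos | now apply Hf].
  - now apply In_configs.
Qed.

(** Taking the mean for [c] recovers the variance; any other [c] gives an upper bound on it. *)
Lemma Epi_centered_sq n f c :
  Epi q n (fun s => (f s - c) * (f s - c)) = Varpi q n f + (Epi q n f - c) * (Epi q n f - c).
Proof.
  rewrite (Epi_ext q n _ (fun s => (f s * f s - (2 * c) * f s) + c * c)) by (intros; ring).
  rewrite Epi_plus, Epi_minus, Epi_scal, Epi_const; unfold Varpi; ring.
Qed.

Lemma Varpi_nonneg n f : 0 <= Varpi q n f.
Proof.
  generalize (Epi_centered_sq n f (Epi q n f)).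
  assert (0 <= Epi q n (fun s => (f s - Epi q n f) * (f s - Epi q n f)))
    by (apply Epi_nonneg; intros; apply Rle_0_sqr).
  lra.
Qed.

Lemma Varpi_ext n f g : (forall s, length s = n -> f s = g s) -> Varpi q n f = Varpi q n g.
Proof.
  intros H; unfold Varpi; f_equal; [|f_equal]; apply Epi_ext; intros s Hs; now rewrite H.
Qed.

(** Every configuration has positive mass, and [f] differs from its mean at one of the two
    witnesses. *)
Lemma Varpi_pos n f : nonconstant n f -> 0 < Varpi q n f.
Proof.
  intros (s1 & s2 & H1 & H2 & Hne); apply In_configs in H1, H2.
  set (mu := Epi q n f).
  assert (K : forall s, length s = n -> f s <> mu -> 0 < Varpi q n f).
  { intros s Hs Hd.
    generalize (Epi_centered_sq n f mu); fold mu.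
    assert (pi_conf q s * ((f s - mu) * (f s - mu))
            <= Epi q n (fun s => (f s - mu) * (f s - mu))).
    { apply (Epi_ge_atom n (fun s => (f s - mu) * (f s - mu))); [|exact Hs].
      intros; apply Rle_0_sqr. }
    assert (0 < pi_conf q s * ((f s - mu) * (f s - mu))).
    { apply Rmult_lt_0_compat; [apply pi_conf_pos | apply Rsqr_pos_lt; lra]. }
    lra. }
  destruct (Req_dec (f s1) mu) as [E1|E1]; [|now apply (K s1)].
  apply (K s2); [exact H2 | congruence].
Qed.

(** Law of total variance, conditioning on the first block. *)
Lemma Varpi_app m n f :
  Varpi q (m + n) f =
  Epi q m (fun a => Varpi q n (fun b => f (a ++ b)))
  + Varpi q m (fun a => Epi q n (fun b => f (a ++ b))).
Proof. unfold Varpi; rewrite Epi_minus, !Epi_app; ring. Qed.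

(** Expanding the nonnegative mean of [w (e g - m)^2] gives [e (e X - m^2)], and [e > 0]. *)
Lemma Epi_weighted_CS n w g :
  (forall s, length s = n -> 0 <= w s) -> 0 < Epi q n w ->
  Epi q n (fun s => w s * g s) * Epi q n (fun s => w s * g s)
  <= Epi q n w * Epi q n (fun s => w s * (g s * g s)).
Proof.
  intros Hw Hpos.
  set (e := Epi q n w) in *; set (m := Epi q n (fun s => w s * g s)).
  assert (H : 0 <= Epi q n (fun s => w s * ((e * g s - m) * (e * g s - m)))).
  { apply Epi_nonneg; intros s Hs; apply Rmult_le_pos; [now apply Hw | apply Rle_0_sqr]. }
  rewrite (Epi_ext q n _ (fun s => ((e * e) * (w s * (g s * g s)) - (2 * e * m) * (w s * g s))
    + (m * m) * w s)) in H by (intros; ring).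
  rewrite Epi_plus, Epi_minus, !Epi_scal in H; fold e m in H.
  set (X := Epi q n (fun s => w s * (g s * g s))) in *.
  assert (0 <= e * (e * X - m * m)) by lra.
  destruct (Rle_or_lt (m * m) (e * X)) as [|Hlt]; [assumption|].
  assert (0 < e * (m * m - e * X)) by (apply Rmult_lt_0_compat; lra). lra.
Qed.
End Measure.

(** * Poincaré inequality by bisection *)

(* The East Dirichlet form when the site to the left of the chain is frozen
   in the state [b]. *)
Fixpoint east_form (q : R) (b : bool) (n : nat) (f : list bool -> R) : R :=
  match n with
  | O => 0
  | S n =>
      (if b then 0 else
         q * (1 - q) * Epi q n (fun s => (f (true :: s) - f (false :: s)) * (f (true :: s) - f (false :: s))))
      + ((1 - q) * east_form q true n (fun s => f (true :: s))
         + q * east_form q false n (fun s => f (false :: s)))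
  end.

Lemma Varx_eq q i f s :
  Varx q i f s =
  q * (1 - q) * ((f (upd i true s) - f (upd i false s)) * (f (upd i true s) - f (upd i false s))).
Proof. unfold Varx, pix; ring. Qed.

Definition boundary_constraint (b : bool) (i : nat) (s : list bool) : R :=
  match i with
  | O => if b then 0 else 1
  | S j => if nth j s false then 0 else 1
  end.

Lemma east_form_sum q b n f :
  east_form q b n f =
  sumL (fun i => Epi q n (fun s => boundary_constraint b i s * Varx q i f s)) (seq 0 n).
Proof.
  revert b f; induction n as [|n IH]; intros b f; [reflexivity|].
  cbn [east_form seq].
  change (sumL ?F (0%nat :: ?l)) with (F 0%nat + sumL F l).
  rewrite <- seq_shift, sumL_map; f_equal.
  - rewrite Epi_S; cbn [boundary_constraint].
    destruct b.
    + rewrite !(Epi_ext q n (fun s => 0 * _) (fun _ => 0)), Epi_const by (intros; ring); ring.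
    + rewrite !(Epi_ext q n (fun s => 1 * _) (fun s => q * (1 - q) *
        ((f (true :: s) - f (false :: s)) * (f (true :: s) - f (false :: s)))))
        by (intros; rewrite Varx_eq; cbn [upd]; ring).
      rewrite Epi_scal; ring.
  - rewrite !IH, <- !sumL_scal, <- sumL_plus; apply sumL_ext; intros i _.
    rewrite Epi_S; f_equal; f_equal; apply Epi_ext; intros s _;
      rewrite !Varx_eq; cbn [upd]; f_equal; destruct i; reflexivity.
Qed.

Lemma Dirichlet_east_form q n f : Dirichlet q n f = east_form q false n f.
Proof. rewrite east_form_sum; reflexivity. Qed.

Lemma last_cons {A} (c : A) s d : last (c :: s) d = last s c.
Proof.
  revert c d; induction s as [|a s IH]; intros c d; [reflexivity|].
  change (last (c :: a :: s) d) with (last (a :: s) d); now rewrite !IH.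
Qed.

Lemma east_form_app q b m n f :
  east_form q b (m + n) f =
  Epi q n (fun t => east_form q b m (fun s => f (s ++ t)))
  + Epi q m (fun s => east_form q (last s b) n (fun t => f (s ++ t))).
Proof.
  revert b f; induction m as [|m IH]; intros b f.
  - cbn [east_form plus]; rewrite Epi_const, Epi_0, Rplus_0_l; reflexivity.
  - cbn [east_form plus]. rewrite !IH, Epi_S.
    rewrite (Epi_ext q m (fun s => east_form q (last (true :: s) b) n _)
      (fun s => east_form q (last s true) n (fun t => f (true :: s ++ t))))
      by (intros; now rewrite last_cons).
    rewrite (Epi_ext q m (fun s => east_form q (last (false :: s) b) n _)
      (fun s => east_form q (last s false) n (fun t => f (false :: s ++ t))))
      by (intros; now rewrite last_cons).
    rewrite !Epi_plus, !Epi_scal.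
    destruct b.
    + rewrite Epi_const; cbn [app]; ring.
    + rewrite Epi_scal, Epi_app, (Epi_swap q m n). cbn [app]; ring.
Qed.

Section TwoBlocks.
Variable q : R.
Hypothesis q_pos : 0 < q.
Hypothesis q_lt1 : q < 1.

Lemma east_form_nonneg b n f : 0 <= east_form q b n f.
Proof.
  revert b f; induction n as [|n IH]; intros b f; simpl; [lra|].
  assert (0 <= Epi q n (fun s => (f (true :: s) - f (false :: s)) * (f (true :: s) - f (false :: s))))
    by (apply Epi_nonneg; trivial; intros; apply Rle_0_sqr).
  assert (H1 := IH true (fun s => f (true :: s))).
  assert (H2 := IH false (fun s => f (false :: s))).
  assert (0 <= q * (1 - q)) by (apply Rmult_le_pos; lra).
  destruct b; repeat apply Rplus_le_le_0_compat; try apply Rmult_le_pos; lra.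
Qed.

(* Compare [f] with its average [psi] over the first block conditioned on [w]:
   the conditioning costs a factor [1 / Epi w]. *)
Lemma two_block_variance m n w f :
  (forall s, length s = m -> 0 <= w s <= 1) -> 0 < Epi q m w ->
  Varpi q (m + n) f <=
  4 / Epi q m w *
  (Epi q n (fun t => Varpi q m (fun s => f (s ++ t)))
   + Epi q m (fun s => w s * Varpi q n (fun t => f (s ++ t)))).
Proof.
  intros Hw He; set (e := Epi q m w) in *.
  set (psi := fun t => Epi q m (fun s => w s * f (s ++ t)) / e).
  set (k := Epi q n psi).
  set (av := fun s => Epi q n (fun t => f (s ++ t))).
  set (VA := fun t => Varpi q m (fun s => f (s ++ t))).
  set (VB := fun s => Varpi q n (fun t => f (s ++ t))).
  assert (He1 : e <= 1).
  { unfold e; rewrite <- (Epi_const q m 1); apply Epi_le; trivial.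
    intros; now apply Hw. }
  (* Cauchy-Schwarz applied to [f - mu]: conditioning on [w] moves the mean over the first block by
     at most the root of [VA t / e]. *)
  assert (HA : forall t, e * ((Epi q m (fun s => f (s ++ t)) - psi t)
      * (Epi q m (fun s => f (s ++ t)) - psi t)) <= VA t).
  { intros t; set (mu := Epi q m (fun s => f (s ++ t))).
    assert (E1 : Epi q m (fun s => w s * (f (s ++ t) - mu)) = e * (psi t - mu)).
    { rewrite (Epi_ext q m _ (fun s => w s * f (s ++ t) - mu * w s)) by (intros; ring).
      rewrite Epi_minus, Epi_scal; fold e; unfold psi; field; lra. }
    assert (CS := Epi_weighted_CS q q_pos q_lt1 m w (fun s => f (s ++ t) - mu)
                    (fun s Hs => proj1 (Hw s Hs)) He).
    cbv beta in CS; rewrite E1 in CS; fold e in CS.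
    assert (Epi q m (fun s => w s * ((f (s ++ t) - mu) * (f (s ++ t) - mu))) <= VA t).
    { replace (VA t) with (Epi q m (fun s => (f (s ++ t) - mu) * (f (s ++ t) - mu))).
      - apply Epi_le; trivial; intros s Hs.
        assert (0 <= (f (s ++ t) - mu) * (f (s ++ t) - mu)) by apply Rle_0_sqr.
        destruct (Hw s Hs); nra.
      - rewrite (Epi_centered_sq q m (fun s => f (s ++ t))); fold mu; unfold VA; ring. }
    apply Rmult_le_reg_l with e; [lra|].
    nra. }
  (* Cauchy-Schwarz over the first block, applied to [f - av], whose weighted mean is
     [e (psi - k)]. *)
  assert (HB : e * Varpi q n psi <= Epi q m (fun s => w s * VB s)).
  { assert (Ek : e * k = Epi q m (fun s => w s * av s)).
    { unfold k; rewrite <- Epi_scal.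
      rewrite (Epi_ext q n _ (fun t => Epi q m (fun s => w s * f (s ++ t))))
        by (intros; unfold psi; field; lra).
      rewrite <- Epi_swap; apply Epi_ext; intros; now rewrite Epi_scal. }
    replace (Varpi q n psi) with (Epi q n (fun t => (psi t - k) * (psi t - k)))
      by (rewrite Epi_centered_sq; fold k; ring).
    replace (Epi q m (fun s => w s * VB s)) with
      (Epi q n (fun t => Epi q m (fun s => w s * ((f (s ++ t) - av s) * (f (s ++ t) - av s))))).
    2:{ rewrite <- Epi_swap; apply Epi_ext; intros s _.
        rewrite Epi_scal, (Epi_centered_sq q n (fun t => f (s ++ t))).
        unfold av, VB; ring. }
    rewrite <- Epi_scal; apply Epi_le; trivial; intros t _.
    assert (E1 : Epi q m (fun s => w s * (f (s ++ t) - av s)) = e * (psi t - k)).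
    { rewrite (Epi_ext q m _ (fun s => w s * f (s ++ t) - w s * av s)) by (intros; ring).
      rewrite Epi_minus, <- Ek; unfold psi; field; lra. }
    assert (CS := Epi_weighted_CS q q_pos q_lt1 m w (fun s => f (s ++ t) - av s)
                    (fun s Hs => proj1 (Hw s Hs)) He).
    cbv beta in CS; rewrite E1 in CS; fold e in CS.
    apply Rmult_le_reg_l with e; [lra|]. nra. }
  (* Split [f - k] into [f - psi] and [psi - k] and use [(a + b)^2 <= 2 a^2 + 2 b^2]. *)
  assert (HV : Varpi q (m + n) f <= 2 * ((1 + / e) * Epi q n VA) + 2 * Varpi q n psi).
  { apply Rle_trans with (Epi q (m + n) (fun s => (f s - k) * (f s - k))).
    { rewrite Epi_centered_sq.
      assert (0 <= (Epi q (m + n) f - k) * (Epi q (m + n) f - k)) by apply Rle_0_sqr. lra. }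
    rewrite Epi_app, Epi_swap.
    replace (Varpi q n psi) with (Epi q n (fun t => (psi t - k) * (psi t - k)))
      by (rewrite Epi_centered_sq; fold k; ring).
    rewrite <- !Epi_scal, <- Epi_plus; apply Epi_le; trivial; intros t _.
    apply Rle_trans with (Epi q m (fun s => 2 * ((f (s ++ t) - psi t) * (f (s ++ t) - psi t))
      + 2 * ((psi t - k) * (psi t - k)))).
    { apply Epi_le; trivial; intros s _.
      assert (0 <= (f (s ++ t) - 2 * psi t + k) * (f (s ++ t) - 2 * psi t + k)) by apply Rle_0_sqr.
      nra. }
    rewrite Epi_plus, Epi_const, Epi_scal, (Epi_centered_sq q m (fun s => f (s ++ t))).
    fold (VA t).
    assert (H := HA t).
    set (X := (Epi q m (fun s => f (s ++ t)) - psi t)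
      * (Epi q m (fun s => f (s ++ t)) - psi t)) in *.
    assert (X <= / e * VA t).
    { apply Rmult_le_reg_l with e; [lra|]. rewrite <- Rmult_assoc, Rinv_r by lra. lra. }
    lra. }
  assert (HA0 : 0 <= Epi q n VA) by (apply Epi_nonneg; trivial; intros; now apply Varpi_nonneg).
  assert (HB0 : Varpi q n psi <= / e * Epi q m (fun s => w s * VB s)).
  { apply Rmult_le_reg_l with e; [lra|]. rewrite <- Rmult_assoc, Rinv_r by lra. lra. }
  assert (HB1 : 0 <= Epi q m (fun s => w s * VB s)).
  { apply Epi_nonneg; trivial; intros s Hs; apply Rmult_le_pos; [now apply Hw | now apply Varpi_nonneg]. }
  assert (H1e : 1 <= / e) by (rewrite <- Rinv_1 at 1; apply Rinv_le_contravar; lra).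
  assert (HA1 : 1 * Epi q n VA <= / e * Epi q n VA) by (apply Rmult_le_compat_r; assumption).
  change (Varpi q (m + n) f <= 4 * / e * (Epi q n VA + Epi q m (fun s => w s * VB s))).
  set (X := Epi q n VA) in *; set (Y := Epi q m (fun s => w s * VB s)) in *.
  assert (0 <= / e * Y) by (apply Rmult_le_pos; lra).
  replace (4 * / e * (X + Y)) with (4 * (/ e * X) + 4 * (/ e * Y)) by ring.
  replace (2 * ((1 + / e) * X)) with (2 * X + 2 * (/ e * X)) in HV by ring.
  lra.
Qed.

Definition has_zero (s : list bool) : R := if forallb (fun b => b) s then 0 else 1.

Lemma Epi_has_zero n : Epi q n has_zero = 1 - (1 - q) ^ n.
Proof.
  induction n as [|n IH]; [rewrite Epi_0; unfold has_zero; simpl; ring|].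
  rewrite Epi_S.
  change (Epi q n (fun s => has_zero (true :: s))) with (Epi q n has_zero).
  change (Epi q n (fun s => has_zero (false :: s))) with (Epi q n (fun _ => 1)).
  rewrite IH, Epi_const; simpl; ring.
Qed.

(** All lengths up to [M] are included because a zero at a random place cuts off a chain of random
    length. *)
Definition poincare (T : R) (M : nat) : Prop :=
  forall m f, (m <= M)%nat -> Varpi q m f <= T * east_form q false m f.

(* The sites to the right of the leftmost zero of the middle block [j] form an
   East chain with a free left boundary. *)
Lemma constrained_block_variance T M j k b g :
  0 <= T -> poincare T M -> (j + k <= S M)%nat ->
  Epi q j (fun s => has_zero s * Varpi q k (fun t => g (s ++ t))) <= T * east_form q b (j + k) g.
Proof.
  intros HT HP; revert b g; induction j as [|j IH]; intros b g Hjk.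
  - rewrite Epi_0; unfold has_zero; simpl forallb; cbv iota.
    rewrite Rmult_0_l; apply Rmult_le_pos; [exact HT | apply east_form_nonneg].
  - rewrite Epi_S; cbn [plus east_form].
    assert (Ht : Epi q j (fun s => has_zero (true :: s) * Varpi q k (fun t => g ((true :: s) ++ t)))
                 <= T * east_form q true (j + k) (fun s => g (true :: s))).
    { apply (IH true (fun s => g (true :: s))); lia. }
    assert (Hf : Epi q j (fun s => has_zero (false :: s) * Varpi q k (fun t => g ((false :: s) ++ t)))
                 <= T * east_form q false (j + k) (fun s => g (false :: s))).
    { apply Rle_trans with (Varpi q (j + k) (fun s => g (false :: s))); [|apply HP; lia].
      rewrite Varpi_app.
      rewrite (Epi_ext q j _ (fun s => Varpi q k (fun t => g (false :: s ++ t))))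
        by (intros; unfold has_zero; simpl forallb; cbv iota; cbn [app]; ring).
      assert (H := Varpi_nonneg q q_pos q_lt1 j (fun a => Epi q k (fun t => g (false :: a ++ t)))).
      lra. }
    assert (Hb : 0 <= T * (if b then 0 else
         q * (1 - q) * Epi q (j + k) (fun s => (g (true :: s) - g (false :: s)) * (g (true :: s) - g (false :: s))))).
    { apply Rmult_le_pos; [exact HT|]. destruct b; [lra|].
      apply Rmult_le_pos; [apply Rmult_le_pos; lra|].
      apply Epi_nonneg; trivial; intros; apply Rle_0_sqr. }
    set (X := if b then 0 else _) in *.
    nra.
Qed.

(** Cut at [M] and condition on a zero in the last [D] sites of the left block. Both terms of the
    two-block bound are at most [T] times the full form, whence [8 = 4 * 2]. The final length leaves
    [D + k <= M + 1]; the leftmost zero occupies one site, so at most [M] sites lie to its right. *)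
Lemma poincare_bisect T M D :
  0 <= T -> poincare T M -> (1 <= D <= M)%nat ->
  poincare (8 / (1 - (1 - q) ^ D) * T) (2 * M + 1 - D).
Proof.
  intros HT HP HD m f Hm.
  set (e := 1 - (1 - q) ^ D).
  assert (He : 0 < e <= 1).
  { unfold e; assert (0 < (1 - q) ^ D) by (apply pow_lt; lra).
    assert ((1 - q) ^ D < 1); [|lra].
    apply pow_lt_1_compat; [lra | lia]. }
  assert (H1e : 1 <= / e) by (rewrite <- Rinv_1 at 1; apply Rinv_le_contravar; lra).
  assert (Hnn := east_form_nonneg false m f).
  destruct (le_lt_dec m M) as [HmM|HmM].
  { apply Rle_trans with (1 := HP m f HmM).
    apply Rmult_le_compat_r; [exact Hnn|]. unfold Rdiv; nra. }
  set (i := (M - D)%nat); set (k := (m - M)%nat).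
  assert (Em : m = (M + k)%nat) by (unfold k; lia).
  assert (EM : M = (i + D)%nat) by (unfold i; lia).
  assert (Hk : (D + k <= S M)%nat) by (unfold k; lia).
  clearbody i k. subst m.
  set (w := fun s => has_zero (skipn i s)).
  assert (Ew : Epi q M w = e).
  { rewrite EM, Epi_app.
    rewrite (Epi_ext q i _ (fun _ => e)); [apply Epi_const|].
    intros s Hs; unfold e; rewrite <- Epi_has_zero; apply Epi_ext; intros t _.
    unfold w; rewrite <- Hs, skipn_app, skipn_all, Nat.sub_diag; reflexivity. }
  assert (Hw : forall s, length s = M -> 0 <= w s <= 1).
  { intros s _; unfold w, has_zero; destruct (forallb _ _); lra. }
  assert (H2 := two_block_variance M k w f Hw).
  rewrite Ew in H2; specialize (H2 (proj1 He)).
  assert (HA : Epi q k (fun t => Varpi q M (fun s => f (s ++ t))) <= T * east_form q false (M + k) f).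
  { apply Rle_trans with (Epi q k (fun t => T * east_form q false M (fun s => f (s ++ t)))).
    - apply Epi_le; trivial; intros; now apply HP.
    - rewrite Epi_scal; apply Rmult_le_compat_l; [exact HT|].
      rewrite east_form_app.
      assert (0 <= Epi q M (fun s => east_form q (last s false) k (fun t => f (s ++ t))))
        by (apply Epi_nonneg; trivial; intros; apply east_form_nonneg).
      lra. }
  (* For fixed first [i] sites, the overlap of [D] sites and the right block form one chain, whose
     left boundary is the last of those sites. *)
  assert (HB : Epi q M (fun s => w s * Varpi q k (fun t => f (s ++ t)))
               <= T * east_form q false (M + k) f).
  { rewrite EM at 1; rewrite Epi_app.
    apply Rle_trans with
      (Epi q i (fun s => T * east_form q (last s false) (D + k) (fun t => f (s ++ t)))).
    - apply Epi_le; trivial; intros s Hs.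
      apply Rle_trans with (2 := constrained_block_variance T M D k (last s false)
        (fun t => f (s ++ t)) HT HP Hk).
      apply Req_le, Epi_ext; intros t _.
      unfold w; rewrite <- Hs, skipn_app, skipn_all, Nat.sub_diag; cbn [app skipn].
      f_equal; apply Varpi_ext; intros; now rewrite app_assoc.
    - rewrite Epi_scal; apply Rmult_le_compat_l; [exact HT|].
      rewrite EM, <- Nat.add_assoc, east_form_app.
      assert (0 <= Epi q (D + k) (fun t => east_form q false i (fun s => f (s ++ t))))
        by (apply Epi_nonneg; trivial; intros; apply east_form_nonneg).
      lra. }
  set (X := east_form q false (M + k) f) in *.
  apply Rle_trans with (1 := H2).
  replace (8 / e * T * X) with (4 / e * (2 * (T * X))) by (field; lra).
  apply Rmult_le_compat_l; [unfold Rdiv; lra | lra].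
Qed.

Lemma poincare_one : poincare 1 1.
Proof.
  intros m f Hm; destruct m as [|[|m]]; [| |lia].
  - unfold Varpi; rewrite !Epi_0; simpl; lra.
  - unfold Varpi; rewrite !Epi_S, !Epi_0; cbn [east_form]; rewrite !Epi_0. nra.
Qed.
End TwoBlocks.

(** * Elementary estimates on powers and factorials *)

Lemma choose2_S k : choose2 (S k) = (choose2 k + k)%nat.
Proof.
  unfold choose2.
  replace (S k * (S k - 1))%nat with (k * (k - 1) + k * 2)%nat by (destruct k; simpl; lia).
  rewrite Nat.div_add; lia.
Qed.

Lemma INR_lt_pow2 n : INR n < 2 ^ n.
Proof.
  replace 2 with (INR 2) by reflexivity; rewrite <- pow_INR; apply lt_INR.
  apply Nat.pow_gt_lin_r; lia.
Qed.

Lemma exists_pow2_ge x : exists r : nat, x <= 2 ^ r.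
Proof.
  destruct (INR_archimed 1 x) as [r Hr]; [lra|].
  exists r; generalize (INR_lt_pow2 r); lra.
Qed.

Lemma pow2_log2_up_bounds L : (1 <= L)%nat ->
  INR L <= 2 ^ Nat.log2_up L /\ 2 ^ Nat.log2_up L <= 2 * INR L.
Proof.
  intros HL; replace 2 with (INR 2) at 1 2 3 by reflexivity.
  rewrite <- pow_INR, <- mult_INR.
  destruct (Nat.eq_dec L 1) as [->|H1]; [split; apply le_INR; simpl; lia|].
  destruct (Nat.log2_up_spec L) as [Ha Hb]; [lia|].
  split; apply le_INR; [exact Hb|].
  assert (0 < Nat.log2_up L)%nat by (apply Nat.log2_up_pos; lia).
  destruct (Nat.log2_up L) as [|p]; [lia|]; cbn [pred] in Ha; rewrite Nat.pow_succ_r'; lia.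
Qed.

Lemma exp_pow_INR x m : exp x ^ m = exp (INR m * x).
Proof.
  induction m as [|m IH]; [now rewrite Rmult_0_l, exp_0|].
  rewrite S_INR; simpl; rewrite IH, <- exp_plus; f_equal; ring.
Qed.

(** By induction, since [(1 + 1/k)^k <= e <= 3]. *)
Lemma pow_self_le_fact k : INR k ^ k <= 3 ^ k * INR (fact k).
Proof.
  induction k as [|k IH]; [simpl; lra|].
  assert (Hr : INR (S k) ^ k <= 3 * INR k ^ k).
  { destruct k as [|k]; [simpl; lra|].
    set (m := S k) in *.
    assert (Hm : 0 < INR m) by (apply lt_0_INR; unfold m; lia).
    replace (INR (S m)) with (INR m * (1 + / INR m)) by (rewrite S_INR; field; lra).
    rewrite Rpow_mult_distr, Rmult_comm.
    apply Rmult_le_compat_r; [apply pow_le; lra|].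
    apply Rle_trans with (exp (/ INR m) ^ m).
    - apply pow_incr; split; [|apply exp_ineq1_le].
      assert (0 < / INR m) by (apply Rinv_0_lt_compat; lra); lra.
    - rewrite exp_pow_INR, Rinv_r by lra; apply exp_le_3. }
  rewrite fact_simpl, mult_INR; cbn [pow].
  assert (0 <= INR (S k)) by apply pos_INR.
  apply Rle_trans with (INR (S k) * (3 * (3 ^ k * INR (fact k)))); [|right; ring].
  apply Rmult_le_compat_l; lra.
Qed.

(** * Iteration of the bisection over dyadic scales *)

Section Upper.
Variable q : R.
Hypothesis q_pos : 0 < q.
Hypothesis q_lt1 : q < 1.

Lemma poincare_le T T' M M' :
  T <= T' -> (M' <= M)%nat -> poincare q T M -> poincare q T' M'.
Proof.
  intros HT HM HP m f Hm.
  apply Rle_trans with (T * east_form q false m f); [apply HP; lia|].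
  apply Rmult_le_compat_r; [now apply east_form_nonneg | exact HT].
Qed.

(* An overlap of a fraction [1 / nu] of the block at each of [nu] doublings
   loses only a constant factor in the final length. *)
Fixpoint bisect_length (nu k : nat) : nat :=
  match k with
  | O => 1
  | S k => 2 * bisect_length nu k - bisect_length nu k / nu
  end.

(** With [x = 1 / (2 nu)], a doubling keeps at least the fraction [1 - x] of the doubled length, and
    [(1 - x) (1 - k x) >= 1 - (k + 1) x]. *)
Lemma bisect_length_bounds nu k : (2 <= nu)%nat ->
  (1 <= bisect_length nu k)%nat /\ INR (bisect_length nu k) <= 2 ^ k /\
  2 ^ k * (1 - INR k / (2 * INR nu)) <= INR (bisect_length nu k).
Proof.
  intros Hnu.
  assert (Hn : 2 <= INR nu) by (apply (le_INR 2); lia).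
  induction k as [|k (IH1 & IH2 & IH3)].
  - simpl; repeat split; try lia; unfold Rdiv; lra.
  - cbn [bisect_length]; set (M := bisect_length nu k) in *.
    assert (Hd : (M / nu <= M)%nat) by (apply Nat.Div0.div_le_upper_bound; nia).
    rewrite minus_INR, mult_INR by lia; simpl (INR 2).
    assert (Hq : INR (M / nu) <= INR M / INR nu).
    { apply Rmult_le_reg_r with (INR nu); [lra|].
      unfold Rdiv; rewrite Rmult_assoc, Rinv_l, Rmult_1_r, <- mult_INR by lra.
      apply le_INR; rewrite Nat.mul_comm; apply Nat.Div0.mul_div_le. }
    assert (Hp : 0 < 2 ^ k) by (apply pow_lt; lra).
    assert (0 <= INR (M / nu)) by apply pos_INR.
    repeat split; [lia | cbn [pow]; lra |].
    rewrite S_INR; cbn [pow].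
    set (x := / (2 * INR nu)).
    assert (Hx : 0 < x <= 1 / 4).
    { split; [apply Rinv_0_lt_compat; lra|].
      unfold x; replace (1 / 4) with (/ 4) by lra; apply Rinv_le_contravar; lra. }
    assert (E : INR M / INR nu = 2 * x * INR M) by (unfold x; field; lra).
    assert (0 <= INR k) by apply pos_INR.
    change (2 ^ k * (1 - INR k * x) <= INR M) in IH3.
    change (2 * 2 ^ k * (1 - (INR k + 1) * x) <= (1 + 1) * INR M - INR (M / nu)).
    apply Rle_trans with (2 * (1 - x) * INR M); [|lra].
    apply Rle_trans with (2 * (1 - x) * (2 ^ k * (1 - INR k * x))); [|apply Rmult_le_compat_l; lra].
    assert (0 <= 2 * 2 ^ k * (INR k * (x * x)))
      by (repeat apply Rmult_le_pos; lra).
    lra.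
Qed.

(** By Bernoulli, [(1 - q)^D (1 + q D) <= ((1 - q) (1 + q))^D <= 1]. *)
Lemma inv_prob_zero_le D : (1 <= D)%nat ->
  / (1 - (1 - q) ^ D) <= (1 + q * INR D) / (q * INR D).
Proof.
  intros HD.
  assert (HDr : 1 <= INR D) by (apply (le_INR 1); lia).
  assert (Hx : 0 < q * INR D) by (apply Rmult_lt_0_compat; lra).
  assert (Hp : (1 - q) ^ D * (1 + q * INR D) <= 1).
  { apply Rle_trans with ((1 - q) ^ D * (1 + q) ^ D).
    - apply Rmult_le_compat_l; [apply pow_le; lra|].
      rewrite (Rmult_comm q); apply poly; lra.
    - rewrite <- Rpow_mult_distr; apply Rle_trans with (1 ^ D); [|rewrite pow1; lra].
      apply pow_incr; nra. }
  apply Rle_trans with (/ (q * INR D / (1 + q * INR D))); [|right; field; lra].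
  apply Rinv_le_contravar; [apply Rdiv_lt_0_compat; lra|].
  apply Rmult_le_reg_r with (1 + q * INR D); [lra|].
  unfold Rdiv; rewrite Rmult_assoc, Rinv_l by lra; lra.
Qed.

(** The bisection at scale [k] costs a factor [8 (1 + X) / (q D)], at most
    [16 (1 + X) nu / (q 2^k)]; the product of the [2^k] builds up the binomial exponent. Here [X]
    dominates [q D] at every scale. *)
Lemma poincare_iterate nu X k : (2 <= nu)%nat -> q * 2 ^ nu <= X -> (k <= nu)%nat ->
  poincare q ((16 * (1 + X) * INR nu / q) ^ k / 2 ^ choose2 k) (bisect_length nu k).
Proof.
  intros Hnu HX.
  assert (Hn : 2 <= INR nu) by (apply (le_INR 2); lia).
  assert (HX0 : 0 < X).
  { apply Rlt_le_trans with (2 := HX); apply Rmult_lt_0_compat; [lra | apply pow_lt; lra]. }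
  set (c := 16 * (1 + X) * INR nu / q).
  assert (Hc : 0 < c).
  { unfold c; apply Rdiv_lt_0_compat; [|lra]; repeat apply Rmult_lt_0_compat; lra. }
  induction k as [|k IH]; intros Hk.
  - replace (c ^ 0 / 2 ^ choose2 0) with 1 by (simpl; field); now apply poincare_one.
  - destruct (bisect_length_bounds nu k Hnu) as (B1 & B2 & B3).
    cbn [bisect_length]; set (M := bisect_length nu k) in *.
    (* The successor ensures [D >= 1] and [nu D >= M], and it cancels the [+ 1] in the length given
       by the bisection. *)
    set (D := S (M / nu)).
    assert (HT : 0 <= c ^ k / 2 ^ choose2 k).
    { apply Rlt_le, Rdiv_lt_0_compat; apply pow_lt; lra. }
    assert (HD : (1 <= D <= M)%nat).
    { unfold D; split; [lia|].
      assert (M / nu <= M / 2)%nat by (apply Nat.div_le_compat_l; lia).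
      assert (M / 2 < M)%nat by (apply Nat.div_lt; lia). lia. }
    assert (P := poincare_bisect q q_pos q_lt1 _ M D HT (IH ltac:(lia)) HD).
    revert P; apply poincare_le; [|unfold D; lia].
    rewrite choose2_S, pow_add; cbn [pow].
    assert (Hp : 0 < 2 ^ k) by (apply pow_lt; lra).
    assert (Hp2 : 0 < 2 ^ choose2 k) by (apply pow_lt; lra).
    replace (c * c ^ k / (2 ^ choose2 k * 2 ^ k)) with (c / 2 ^ k * (c ^ k / 2 ^ choose2 k))
      by (field; lra).
    apply Rmult_le_compat_r; [exact HT|].
    assert (HDr : 1 <= INR D) by (apply (le_INR 1); lia).
    assert (HqD : q * INR D <= X).
    { apply Rle_trans with (2 := HX); apply Rmult_le_compat_l; [lra|].
      apply Rle_trans with (INR M); [apply le_INR; lia|].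
      apply Rle_trans with (1 := B2); apply Rle_pow; [lra | lia]. }
    (* As [k <= nu], at least half of [2^k] has survived in [M]. *)
    assert (HDM : 2 ^ k <= 2 * INR nu * INR D).
    { assert (HkN : INR k / (2 * INR nu) <= / 2).
      { apply Rmult_le_reg_r with (2 * INR nu); [lra|].
        unfold Rdiv; rewrite Rmult_assoc, Rinv_l, Rmult_1_r by lra.
        assert (INR k <= INR nu) by (apply le_INR; lia). lra. }
      assert (2 ^ k <= 2 * INR M) by nra.
      assert (INR M <= INR nu * INR D); [|lra].
      rewrite <- mult_INR; apply le_INR; unfold D.
      generalize (Nat.mul_succ_div_gt M nu); lia. }
    apply Rle_trans with (8 * ((1 + X) / (q * INR D))).
    { unfold Rdiv; apply Rmult_le_compat_l; [lra|].
      apply Rle_trans with (1 := inv_prob_zero_le D (proj1 HD)).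
      apply Rmult_le_compat_r; [|lra].
      apply Rlt_le, Rinv_0_lt_compat, Rmult_lt_0_compat; lra. }
    apply Rmult_le_reg_r with (q * INR D * 2 ^ k);
      [repeat apply Rmult_lt_0_compat; lra|].
    replace (8 * ((1 + X) / (q * INR D)) * (q * INR D * 2 ^ k))
      with (8 * (1 + X) * 2 ^ k) by (field; lra).
    replace (c / 2 ^ k * (q * INR D * 2 ^ k)) with (8 * (1 + X) * (2 * INR nu * INR D))
      by (unfold c; field; lra).
    apply Rmult_le_compat_l; lra.
Qed.

(** Half of [2^(n + 2)] survives [n + 2] doublings, which covers [2^n]. *)
Lemma poincare_dyadic n X : q * 2 ^ (n + 2) <= X ->
  poincare q ((16 * (1 + X) * INR (n + 2) / q) ^ (n + 2) / 2 ^ choose2 (n + 2)) (2 ^ n).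
Proof.
  intros HX.
  assert (P := poincare_iterate (n + 2) X (n + 2) ltac:(lia) HX (le_n _)).
  revert P; apply poincare_le; [lra|].
  destruct (bisect_length_bounds (n + 2) (n + 2) ltac:(lia)) as (_ & _ & B).
  apply INR_le, Rle_trans with (2 := B).
  assert (0 < INR (n + 2)) by (apply lt_0_INR; lia).
  replace (INR (n + 2) / (2 * INR (n + 2))) with (/ 2) by (field; lra).
  rewrite pow_INR, pow_add; simpl (INR 2).
  replace (1 + 1) with 2 by lra; assert (0 < 2 ^ n) by (apply pow_lt; lra); nra.
Qed.
End Upper.

Lemma Dirichlet_lower_bound d : 0 < d -> exists a : nat, (1 <= a)%nat /\
  forall q L, 0 < q -> q < 1 / 2 -> (1 <= L)%nat -> INR L <= d / q ->
  forall f, Varpi q L f <= east_scale q (Nat.log2_up L) * (/ q) ^ a * Dirichlet q L f.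
Proof.
  intros Hd.
  destruct (exists_pow2_ge (8 * d)) as [r Hr].
  (* [192 = 16 * 12], where 16 comes from the iterated bisection and 12 from replacing
     [(n + 2)^(n + 2)] by [n!]. *)
  destruct (exists_pow2_ge (192 * (1 + 8 * d))) as [c Hc].
  (* The 2 pays for [Q^(n + 2)] in place of [Q^n], the rest for constants to the power [n + 2]. *)
  exists (2 + (r + 1) * c)%nat; split; [lia|].
  intros q L Hq Hq2 HL HLd f.
  destruct (pow2_log2_up_bounds L HL) as [Ha Hb].
  set (n := Nat.log2_up L) in *.
  set (Q := / q).
  assert (HqQ : q * Q = 1) by (unfold Q; field; lra).
  assert (HQ : 2 < Q).
  { unfold Q; replace 2 with (/ (1 / 2)) by lra; apply Rinv_lt_contravar; nra. }
  assert (HX : q * 2 ^ (n + 2) <= 8 * d).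
  { rewrite pow_add; replace (2 ^ 2) with 4 by ring.
    apply Rle_trans with (q * (8 * (d / q))); [|right; field; lra].
    apply Rmult_le_compat_l; lra. }
  assert (P := poincare_dyadic q Hq ltac:(lra) n (8 * d) HX L f).
  rewrite <- Dirichlet_east_form in P.
  assert (HLn : (L <= 2 ^ n)%nat).
  { apply INR_le; rewrite pow_INR; exact Ha. }
  apply Rle_trans with (1 := P HLn).
  assert (HD : 0 <= Dirichlet q L f) by (rewrite Dirichlet_east_form; apply east_form_nonneg; lra).
  apply Rmult_le_compat_r; [exact HD|].
  set (X := 8 * d) in *.
  assert (Hn2 : INR (n + 2) ^ (n + 2) <= 12 ^ (n + 2) * INR (fact n)).
  { apply Rle_trans with (1 := pow_self_le_fact (n + 2)).
    replace 12 with (3 * 4) by ring; rewrite Rpow_mult_distr, Rmult_assoc.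
    apply Rmult_le_compat_l; [apply pow_le; lra|].
    replace (n + 2)%nat with (S (S n)) by lia.
    rewrite !fact_simpl, !mult_INR, <- Rmult_assoc.
    apply Rmult_le_compat_r; [apply pos_INR|].
    replace 4 with (2 * 2) by ring; rewrite Rpow_mult_distr.
    apply Rmult_le_compat; try apply pos_INR.
    - apply Rlt_le, INR_lt_pow2.
    - apply Rle_trans with (2 ^ S n); [apply Rlt_le, INR_lt_pow2|].
      apply Rle_pow; [lra|lia]. }
  (* Since [2^(n + 2) <= X Q <= Q^(r + 1)], a constant [2^c] to the power [n + 2] is a fixed power
     of [Q]. *)
  assert (Hexp : (192 * (1 + X)) ^ (n + 2) <= Q ^ ((r + 1) * c)).
  { apply Rle_trans with ((2 ^ c) ^ (n + 2)); [apply pow_incr; unfold X in *; lra|].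
    rewrite <- pow_mult, Nat.mul_comm, !pow_mult; apply pow_incr.
    split; [apply pow_le; lra|].
    apply Rle_trans with (X * Q).
    { apply Rmult_le_reg_l with q; [lra|]. replace (q * (X * Q)) with (X * (q * Q)) by ring.
      rewrite HqQ; lra. }
    rewrite pow_add, pow_1; apply Rmult_le_compat_r; [lra|].
    apply Rle_trans with (1 := Hr); apply pow_incr; lra. }
  assert (Hf : 0 < INR (fact n)) by (apply lt_0_INR, lt_O_fact).
  assert (Hch : 2 ^ choose2 n <= 2 ^ choose2 (n + 2)).
  { apply Rle_pow; [lra|]. replace (n + 2)%nat with (S (S n)) by lia.
    rewrite !choose2_S; lia. }
  assert (Hcp : 0 < 2 ^ choose2 n) by (apply pow_lt; lra).
  assert (HQn : forall k, 0 < Q ^ k) by (intros; apply pow_lt; lra).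
  assert (HX0 : 0 < X) by (unfold X; lra).
  replace (16 * (1 + X) * INR (n + 2) / q) with (16 * (1 + X) * Q * INR (n + 2))
    by (unfold Q; field; lra).
  replace (east_scale q n) with (INR (fact n) * Q ^ n / 2 ^ choose2 n).
  2:{ unfold east_scale, Q; rewrite pow_inv; field; split; [lra|apply pow_nonzero; lra]. }
  apply Rle_trans with ((16 * (1 + X) * Q * INR (n + 2)) ^ (n + 2) / 2 ^ choose2 n).
  { unfold Rdiv; apply Rmult_le_compat_l.
    - apply pow_le; repeat apply Rmult_le_pos; try lra; apply pos_INR.
    - apply Rinv_le_contravar; lra. }
  replace (INR (fact n) * Q ^ n / 2 ^ choose2 n * Q ^ (2 + (r + 1) * c))
    with (Q ^ (n + 2) * Q ^ ((r + 1) * c) * INR (fact n) / 2 ^ choose2 n)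
    by (rewrite !pow_add; unfold Rdiv; ring).
  unfold Rdiv; apply Rmult_le_compat_r; [apply Rlt_le, Rinv_0_lt_compat; lra|].
  rewrite Rpow_mult_distr.
  apply Rle_trans with ((16 * (1 + X) * Q) ^ (n + 2) * (12 ^ (n + 2) * INR (fact n))).
  { apply Rmult_le_compat_l; [apply pow_le; repeat apply Rmult_le_pos; lra | exact Hn2]. }
  rewrite <- !Rmult_assoc; apply Rmult_le_compat_r; [lra|].
  rewrite <- Rpow_mult_distr.
  replace (16 * (1 + X) * Q * 12) with (Q * (192 * (1 + X))) by ring.
  rewrite Rpow_mult_distr; apply Rmult_le_compat_l; [apply Rlt_le, HQn | exact Hexp].
Qed.

Open Scope nat_scope.

(** * Lifetimes of zeros and growth of intervals *)

(* A zero at [v] dies at time [j] when the zero at distance [j] to its left is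
   still alive; the frozen zero at the origin lives until [B]. Sites without a
   zero have lifetime [0]. *)
Definition is_lifetime (z : nat -> bool) (B : nat) (T : nat -> nat) : Prop :=
  T 0 = B /\
  forall v, 1 <= v ->
    (z v = false -> T v = 0) /\
    (z v = true -> 1 <= T v <= v /\ T v <= T (v - T v) /\ forall j, 1 <= j < T v -> T (v - j) < j).

(** The list holds lifetimes at distances [j], [j + 1], and so on; the search stops at the first one
    that reaches its distance. An exhausted list returns the default 0. *)
Fixpoint first_reach (j : nat) (l : list nat) : nat :=
  match l with
  | [] => 0
  | t :: l => if j <=? t then j else first_reach (S j) l
  end.

(* [lives z B k] lists the lifetimes of the sites [k], [k - 1], ..., [0]. *)
Fixpoint lives (z : nat -> bool) (B k : nat) : list nat :=
  match k with
  | O => [B]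
  | S k => (if z (S k) then first_reach 1 (lives z B k) else 0) :: lives z B k
  end.

Definition life (z : nat -> bool) (B k : nat) : nat := hd 0 (lives z B k).

Lemma first_reach_spec l : forall j,
  (exists i, i < length l /\ j + i <= nth i l 0) ->
  exists i, i < length l /\ first_reach j l = j + i /\ j + i <= nth i l 0 /\
    forall i', i' < i -> nth i' l 0 < j + i'.
Proof.
  induction l as [|t l IH]; intros j (i & Hi & Hj); [simpl in Hi; lia|].
  simpl first_reach; destruct (Nat.leb_spec j t) as [Hle|Hlt].
  - exists 0; simpl; repeat split; lia.
  - destruct i as [|i]; [simpl in Hj; lia|].
    destruct (IH (S j)) as (i0 & H1 & H2 & H3 & H4).
    { exists i; simpl in *; split; lia. }
    exists (S i0); simpl; repeat split; try lia.
    intros [|i'] Hi'; [lia|]. specialize (H4 i'); lia.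
Qed.

Lemma lives_nth z B k j : j <= k -> nth j (lives z B k) 0 = life z B (k - j).
Proof.
  revert j; induction k as [|k IH]; intros [|j] Hj; try reflexivity; [lia|].
  simpl; apply IH; lia.
Qed.

Lemma lives_length z B k : length (lives z B k) = S k.
Proof. induction k; simpl; auto. Qed.

(** A zero at [v <= B] finds a parent at the latest at the origin, at distance [v], so its search
    never returns the default. *)
Lemma life_is_lifetime z B : (forall v, z v = true -> v <= B) -> is_lifetime z B (life z B).
Proof.
  intros Hz; split; [reflexivity|].
  intros [|k] Hv; [lia|].
  assert (E : life z B (S k) = if z (S k) then first_reach 1 (lives z B k) else 0) by reflexivity.
  split; intros Hzv; rewrite Hzv in E; [exact E|].
  destruct (first_reach_spec (lives z B k) 1) as (i & H1 & H2 & H3 & H4).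
  { exists k; rewrite lives_length, lives_nth, Nat.sub_diag by lia.
    split; [lia|]. specialize (Hz _ Hzv); unfold life; simpl; lia. }
  rewrite lives_length in H1; rewrite E, H2.
  rewrite lives_nth in H3 by lia.
  repeat split; try lia.
  - replace (S k - (1 + i)) with (k - i) by lia; exact H3.
  - intros [|j] Hj; [lia|].
    specialize (H4 j ltac:(lia)); rewrite lives_nth in H4 by lia.
    simpl; lia.
Qed.

(** The condition [j <= hi - lo] lets each step at most double the length. The step count later
    bounds the recursion depth of [chains]. *)
Inductive grows (z : nat -> bool) (a b : nat) : nat -> nat -> nat -> Prop :=
| grows_refl : grows z a b 0 a b
| grows_right k lo hi j : grows z a b k lo hi -> 1 <= j -> j <= hi - lo ->
    z (hi + j) = true -> grows z a b (S k) lo (hi + j)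
| grows_left k lo hi j : grows z a b k lo hi -> 1 <= j -> j <= hi - lo -> j <= lo ->
    z (lo - j) = true -> grows z a b (S k) (lo - j) hi.

Lemma grows_bounds z a b k lo hi : a <= b -> grows z a b k lo hi ->
  lo <= a /\ b <= hi /\ k + b + lo <= hi + a.
Proof. intros Hab H; induction H; lia. Qed.

Section Discrepancy.
Variables (x B : nat) (z : nat -> bool).
Hypothesis x_pos : 1 <= x.
Hypothesis z_origin : z 0 = true.
Hypothesis z_pred : z (x - 1) = true.

(** Both states of the flipped site are compared with one reference [z]. The bound by [B] makes the
    origin survive up to the distance of every zero. *)
Definition agrees_off_x (z' : nat -> bool) : Prop :=
  (forall v, v <> x -> z' v = z v) /\ forall v, z' v = true -> v <= B.

Lemma lifetime_pos z' T v :
  is_lifetime z' B T -> z' v = true -> 1 <= B -> 1 <= T v.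
Proof.
  intros [T0 TS] Hv HB; destruct v as [|v]; [lia|].
  now apply TS; [lia|].
Qed.

(* Following the ancestors of [cur], each jump at most doubles the distance to [v]. *)
Lemma grows_to_parent z' T v cur :
  agrees_off_x z' -> is_lifetime z' B T -> 1 <= B -> z' v = true -> x < v ->
  cur < v -> z' cur = true ->
  forall k lo, grows z (x - 1) x k lo v -> lo <= cur ->
  exists k' lo', grows z (x - 1) x k' lo' v /\ lo' + T v <= v.
Proof.
  intros Hz HT HB Hv Hxv.
  induction cur as [cur IH] using lt_wf_ind; intros Hcur Hzc k lo Hg Hlo.
  pose proof (lifetime_pos z' T cur HT Hzc HB) as Hpos.
  destruct (grows_bounds _ _ _ _ _ _ (Nat.le_sub_l x 1) Hg) as (G1 & _ & _).
  destruct HT as [T0 TS]; destruct Hz as [Hz1 Hz2].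
  destruct (TS v ltac:(lia)) as [_ Tv]; specialize (Tv Hv); destruct Tv as (Tv1 & Tv2 & Tv3).
  destruct (le_lt_dec (v - cur) (T cur)) as [Hle|Hlt].
  - exists k, lo; split; [exact Hg|].
    destruct (le_lt_dec (T v) (v - cur)) as [|Hgt]; [lia|].
    specialize (Tv3 (v - cur) ltac:(lia)); replace (v - (v - cur)) with cur in Tv3 by lia; lia.
  - assert (Hc0 : cur <> 0) by (intros ->; specialize (Hz2 v Hv); lia).
    destruct (TS cur ltac:(lia)) as [_ Tc]; specialize (Tc Hzc); destruct Tc as (Tc1 & Tc2 & _).
    set (next := cur - T cur) in *.
    assert (Hzn : z' next = true).
    { destruct (z' next) eqn:E; [reflexivity|].
      destruct (Nat.eq_dec next 0) as [E0|E0].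
      - rewrite E0, (Hz1 0), z_origin in E by lia; discriminate.
      - destruct (TS next ltac:(lia)) as [Tn _]; specialize (Tn E); lia. }
    destruct (le_lt_dec lo next) as [Hln|Hln].
    + now apply (IH next ltac:(unfold next; lia) ltac:(lia) Hzn k lo).
    + apply (IH next ltac:(unfold next; lia) ltac:(lia) Hzn (S k) next); [|lia].
      replace next with (lo - (lo - next)) by lia.
      apply grows_left; try (unfold next in *; lia); [exact Hg|].
      replace (lo - (lo - next)) with next by lia.
      rewrite <- Hz1; [exact Hzn | lia].
Qed.

(** Here [p] is the parent of [v] in the first configuration. In the second one [v] survives past
    time [TA v], so [p] must be dead by then: a discrepancy at [v] forces one at [p < v]. *)
Lemma lifetime_smaller_witness zA zB TA TB v :
  agrees_off_x zA -> agrees_off_x zB -> is_lifetime zA B TA -> is_lifetime zB B TB ->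
  x <> v -> TA v < TB v ->
  let p := v - TA v in 1 <= v /\ p < v /\ TA v <= TA p /\ TB p < TA v /\ zA v = true /\ zB v = true.
Proof.
  intros HA HB LA LB Hxv Hlt; destruct LA as [A0 AS]; destruct LB as [B0 BS].
  assert (Hv : 1 <= v) by (destruct v; lia).
  destruct (AS v Hv) as [A1 A2]; destruct (BS v Hv) as [B1 B2].
  assert (EA : zA v = zB v) by (rewrite (proj1 HA), (proj1 HB); auto).
  destruct (zB v) eqn:E; [|specialize (B1 eq_refl); lia].
  specialize (A2 EA); specialize (B2 eq_refl).
  destruct A2 as (A2 & A3 & _); destruct B2 as (_ & _ & B2).
  specialize (B2 (TA v) ltac:(lia)); repeat split; auto; lia.
Qed.

(** A discrepancy left of [x] would force another one further left. *)
Lemma lifetime_left_of_x zA zB TA TB v :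
  agrees_off_x zA -> agrees_off_x zB -> is_lifetime zA B TA -> is_lifetime zB B TB ->
  v < x -> TA v = TB v.
Proof.
  intros HA HB LA LB; induction v as [v IH] using lt_wf_ind; intros Hv.
  destruct (lt_eq_lt_dec (TA v) (TB v)) as [[Hlt|]|Hlt]; [exfalso|assumption|exfalso].
  - destruct (lifetime_smaller_witness zA zB TA TB v HA HB LA LB ltac:(lia) Hlt)
      as (_ & P1 & P2 & P3 & _).
    specialize (IH _ P1 ltac:(lia)); lia.
  - destruct (lifetime_smaller_witness zB zA TB TA v HB HA LB LA ltac:(lia) Hlt)
      as (_ & P1 & P2 & P3 & _).
    specialize (IH _ P1 ltac:(lia)); lia.
Qed.

(** The adjacent zero at [x - 1] is alive at time 1. *)
Lemma lifetime_at_x z' T : agrees_off_x z' -> is_lifetime z' B T -> 1 <= B -> T x <= 1.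
Proof.
  intros Hz HT HB.
  assert (Hp : 1 <= T (x - 1)).
  { apply (lifetime_pos z' T); auto. rewrite (proj1 Hz); [exact z_pred | lia]. }
  destruct HT as [T0 TS]; destruct (TS x x_pos) as [H1 H2].
  destruct (z' x); [|rewrite (H1 eq_refl); lia].
  destruct (H2 eq_refl) as (_ & _ & H3).
  destruct (le_lt_dec (T x) 1) as [|Hlt]; [assumption|].
  specialize (H3 1 ltac:(lia)); lia.
Qed.

(** The interval reaching [p] has length at least [TA p >= TA v = v - p], so a right step to [v] is
    allowed. Left steps along ancestors in the second configuration then reach back as far as the
    parent of [v] there. *)
Lemma discrepancy_grows_aux zA zB TA TB v :
  agrees_off_x zA -> agrees_off_x zB -> is_lifetime zA B TA -> is_lifetime zB B TB -> 1 <= B ->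
  (forall p, p < v -> TA p <> TB p ->
     exists k lo, grows z (x - 1) x k lo p /\ lo + TA p <= p /\ lo + TB p <= p) ->
  x < v -> TA v < TB v ->
  exists k lo, grows z (x - 1) x k lo v /\ lo + TB v <= v.
Proof.
  intros HA HB LA LB B_pos IH Hxv Hlt.
  destruct (lifetime_smaller_witness zA zB TA TB v HA HB LA LB ltac:(lia) Hlt)
    as (_ & P1 & P2 & P3 & ZA & ZB).
  set (p := v - TA v) in *.
  destruct (IH p P1 ltac:(lia)) as (k & lo & Hg & L1 & L2).
  assert (Hp : x <= p).
  { destruct (le_lt_dec x p) as [|Hpx]; [assumption|].
    generalize (lifetime_left_of_x zA zB TA TB p HA HB LA LB Hpx); lia. }
  destruct (grows_bounds _ _ _ _ _ _ (Nat.le_sub_l x 1) Hg) as (G1 & _ & _).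
  assert (Hg' : grows z (x - 1) x (S k) lo v).
  { replace v with (p + TA v) by lia; apply grows_right; auto; try lia.
    replace (p + TA v) with v by lia; rewrite <- (proj1 HA); [exact ZA | lia]. }
  (* If [p] is no zero of the second configuration, it must be [x], and the ancestor search starts
     from [x - 1] instead. *)
  destruct (zB p) eqn:Ep.
  - now apply (grows_to_parent zB TB v p HB LB B_pos ZB Hxv P1 Ep (S k) lo); [|lia].
  - assert (E : p = x).
    { destruct (Nat.eq_dec p x) as [|Hne]; [assumption|exfalso].
      rewrite (proj1 HB), <- (proj1 HA) in Ep by assumption.
      destruct LA as [_ AS]; destruct (AS p ltac:(lia)) as [A1 _].
      specialize (A1 Ep); lia. }
    apply (grows_to_parent zB TB v (x - 1) HB LB B_pos ZB Hxv ltac:(lia)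
      ltac:(rewrite (proj1 HB); [exact z_pred | lia]) (S k) lo); [exact Hg' | lia].
Qed.

Lemma discrepancy_grows zA zB TA TB v :
  agrees_off_x zA -> agrees_off_x zB -> is_lifetime zA B TA -> is_lifetime zB B TB -> 1 <= B ->
  TA v <> TB v ->
  exists k lo, grows z (x - 1) x k lo v /\ lo + TA v <= v /\ lo + TB v <= v.
Proof.
  intros HA HB LA LB B_pos; induction v as [v IH] using lt_wf_ind; intros Hne.
  destruct (lt_eq_lt_dec v x) as [[Hvx| ->]|Hvx].
  - destruct Hne; now apply (lifetime_left_of_x zA zB).
  - exists 0, (x - 1); split; [apply grows_refl|].
    generalize (lifetime_at_x zA TA HA LA B_pos) (lifetime_at_x zB TB HB LB B_pos); lia.
  - destruct (lt_eq_lt_dec (TA v) (TB v)) as [[Hlt|]|Hlt]; [|lia|].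
    + destruct (discrepancy_grows_aux zA zB TA TB v HA HB LA LB B_pos IH Hvx Hlt)
        as (k & lo & Hg & Hl).
      exists k, lo; repeat split; auto; lia.
    + destruct (discrepancy_grows_aux zB zA TB TA v HB HA LB LA B_pos) as (k & lo & Hg & Hl); auto.
      { intros p Hp Hd; destruct (IH p Hp ltac:(auto)) as (k & lo & Hk & L1 & L2); eauto. }
      exists k, lo; repeat split; auto; lia.
Qed.
End Discrepancy.

Close Scope nat_scope.

(** * Expected number of growth chains *)

(* Sites are numbered from 1 here, and the origin carries the frozen zero. *)
Definition zero_at (s : list bool) (v : nat) : bool :=
  match v with
  | O => true
  | S i => negb (nth i s true)
  end.

Definition zero_ind (s : list bool) (v : nat) : R := if zero_at s v then 1 else 0.

(* Dominates the indicator that [lo, hi] can grow to length [T]; its expectation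
   factorizes because the zeros used later lie outside the current interval. *)
Fixpoint chains (T fuel lo hi : nat) (s : list bool) : R :=
  if (T <=? hi - lo)%nat then 1 else
  match fuel with
  | O => 0
  | S fuel =>
      sumL (fun j => zero_ind s (hi + j) * chains T fuel lo (hi + j) s) (seq 1 (hi - lo))
      + sumL (fun j => if (j <=? lo)%nat
                       then zero_ind s (lo - j) * chains T fuel (lo - j) hi s else 0)
             (seq 1 (hi - lo))
  end.

Lemma zero_ind_nonneg s v : 0 <= zero_ind s v.
Proof. unfold zero_ind; destruct (zero_at s v); lra. Qed.

Lemma chains_nonneg T fuel lo hi s : 0 <= chains T fuel lo hi s.
Proof.
  revert lo hi; induction fuel as [|fuel IH]; intros lo hi; cbn [chains];
    destruct (T <=? hi - lo)%nat; try lra.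
  apply Rplus_le_le_0_compat; apply sumL_nonneg; intros j _.
  - apply Rmult_le_pos; [apply zero_ind_nonneg | apply IH].
  - destruct (j <=? lo)%nat; [|lra].
    apply Rmult_le_pos; [apply zero_ind_nonneg | apply IH].
Qed.

Lemma upd_length i b s : length (upd i b s) = length s.
Proof. revert i; induction s as [|a s IH]; intros [|i]; simpl; auto. Qed.

Lemma nth_upd_other i j b s d : i <> j -> nth j (upd i b s) d = nth j s d.
Proof.
  revert i j; induction s as [|a s IH]; intros [|i] [|j] H; simpl; auto; lia.
Qed.

Lemma zero_at_upd_other i b s v : v <> S i -> zero_at (upd i b s) v = zero_at s v.
Proof. intros H; destruct v as [|v]; [reflexivity|]; simpl; rewrite nth_upd_other; auto. Qed.

(** Every zero tested by the recursion lies strictly outside the current interval. *)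
Lemma chains_upd_inside T fuel lo hi i b s : (lo <= S i <= hi)%nat ->
  chains T fuel lo hi (upd i b s) = chains T fuel lo hi s.
Proof.
  revert lo hi; induction fuel as [|fuel IH]; intros lo hi H; cbn [chains];
    destruct (T <=? hi - lo)%nat; try reflexivity.
  f_equal; apply sumL_ext; intros j Hj; apply in_seq in Hj.
  - unfold zero_ind; rewrite zero_at_upd_other, IH by lia; reflexivity.
  - destruct (Nat.leb_spec j lo); [|reflexivity].
    unfold zero_ind; rewrite zero_at_upd_other, IH by lia; reflexivity.
Qed.

Section ExpectedChains.
Variable q : R.
Hypothesis q_pos : 0 < q.
Hypothesis q_lt1 : q < 1.

(** Independence of site [S i] from [F]. Only an inequality holds, because sites beyond the chain
    count as having no zero. *)
Lemma Epi_zero_ind_indep n i F :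
  (forall s, 0 <= F s) -> (forall b s, F (upd i b s) = F s) ->
  Epi q n (fun s => zero_ind s (S i) * F s) <= q * Epi q n F.
Proof.
  revert i F; induction n as [|n IH]; intros i F Hpos HF.
  - rewrite !Epi_0; replace (zero_ind [] (S i)) with 0 by (destruct i; reflexivity).
    rewrite Rmult_0_l; apply Rmult_le_pos; [lra | apply Hpos].
  - rewrite !Epi_S; destruct i as [|i].
    + rewrite (Epi_ext q n (fun s => zero_ind (true :: s) 1 * F (true :: s)) (fun _ => 0))
        by (intros; unfold zero_ind; simpl; ring).
      rewrite (Epi_ext q n (fun s => zero_ind (false :: s) 1 * F (false :: s)) (fun s => F (false :: s)))
        by (intros; unfold zero_ind; simpl; ring).
      rewrite (Epi_ext q n (fun s => F (true :: s)) (fun s => F (false :: s)))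
        by (intros s _; apply (HF true (false :: s))).
      rewrite Epi_const; right; ring.
    + assert (H1 : Epi q n (fun s => zero_ind (true :: s) (S (S i)) * F (true :: s))
                    <= q * Epi q n (fun s => F (true :: s)))
        by exact (IH i (fun s => F (true :: s)) (fun s => Hpos _) (fun b s => HF b (true :: s))).
      assert (H2 : Epi q n (fun s => zero_ind (false :: s) (S (S i)) * F (false :: s))
                    <= q * Epi q n (fun s => F (false :: s)))
        by exact (IH i (fun s => F (false :: s)) (fun s => Hpos _) (fun b s => HF b (false :: s))).
      apply (Rmult_le_compat_l (1 - q)) in H1; [|lra].
      apply (Rmult_le_compat_l q) in H2; [|lra].
      lra.
Qed.

(* The zero at the origin is free: an interval that has not yet reached it
   pays one factor [q] too few. *)
Definition origin_cost (lo : nat) : R := match lo with O => 1 | S _ => / q end.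

(** A supersolution argument by induction on the fuel, the 2 counting the two sides. Each step pays
    [q] for its new zero, except a left step to the origin, where the drop of [origin_cost] from
    [1 / q] to 1 pays instead. *)
Lemma expected_chains_le T (h : nat -> R) n :
  (forall t, 0 <= h t) -> (forall t, (T <= t)%nat -> 1 <= h t) ->
  (forall t, (1 <= t < T)%nat -> 2 * q * sumL (fun j => h (t + j)%nat) (seq 1 t) <= h t) ->
  forall fuel lo hi, (lo < hi)%nat ->
  Epi q n (chains T fuel lo hi) <= origin_cost lo * h (hi - lo)%nat.
Proof.
  intros Hpos Hbig Hsuper.
  assert (Hq1 : 1 <= / q) by (rewrite <- Rinv_1 at 1; apply Rinv_le_contravar; lra).
  assert (Hc : forall lo, 1 <= origin_cost lo) by (intros [|lo]; simpl; lra).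
  induction fuel as [|fuel IH]; intros lo hi Hlt; cbn [chains];
    destruct (Nat.leb_spec T (hi - lo)) as [Hle|Hgt].
  - rewrite Epi_const; generalize (Hc lo) (Hbig _ Hle); nra.
  - rewrite Epi_const; apply Rmult_le_pos; [generalize (Hc lo); lra | apply Hpos].
  - rewrite Epi_const; generalize (Hc lo) (Hbig _ Hle); nra.
  - rewrite Epi_plus, !Epi_sumL.
    set (t := (hi - lo)%nat) in *.
    assert (HR : sumL (fun j => Epi q n (fun s => zero_ind s (hi + j) * chains T fuel lo (hi + j) s))
        (seq 1 t) <= sumL (fun j => origin_cost lo * q * h (t + j)%nat) (seq 1 t)).
    { apply sumL_le; intros j Hj; apply in_seq in Hj.
      assert (Hind := Epi_zero_ind_indep n (hi + j - 1) (chains T fuel lo (hi + j))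
        (chains_nonneg T fuel lo (hi + j))
        ltac:(intros; apply chains_upd_inside; lia)).
      replace (S (hi + j - 1)) with (hi + j)%nat in Hind by lia.
      apply Rle_trans with (1 := Hind).
      rewrite (Rmult_comm (origin_cost lo)), Rmult_assoc; apply Rmult_le_compat_l; [lra|].
      replace (t + j)%nat with (hi + j - lo)%nat by (unfold t; lia).
      apply IH; lia. }
    assert (HL : sumL (fun j => Epi q n (fun s => if (j <=? lo)%nat
          then zero_ind s (lo - j) * chains T fuel (lo - j) hi s else 0)) (seq 1 t)
        <= sumL (fun j => origin_cost lo * q * h (t + j)%nat) (seq 1 t)).
    { apply sumL_le; intros j Hj; apply in_seq in Hj.
      destruct (Nat.leb_spec j lo) as [Hj2|Hj2].
      - assert (Hlo : origin_cost lo * q = 1) by (destruct lo; [lia|]; simpl; field; lra).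
        rewrite Hlo, Rmult_1_l.
        replace (t + j)%nat with (hi - (lo - j))%nat by (unfold t; lia).
        assert (IHj := IH (lo - j)%nat hi ltac:(lia)).
        destruct (lo - j)%nat as [|v] eqn:Ev.
        + rewrite (Epi_ext q n _ (chains T fuel 0 hi))
            by (intros; unfold zero_ind; simpl zero_at; cbv iota; ring).
          simpl origin_cost in IHj; lra.
        + apply Rle_trans with (1 := Epi_zero_ind_indep n v (chains T fuel (S v) hi)
            (chains_nonneg T fuel (S v) hi) ltac:(intros; apply chains_upd_inside; lia)).
          apply Rle_trans with (q * (/ q * h (hi - S v)%nat));
            [apply Rmult_le_compat_l; [lra | exact IHj]|].
          right; field; lra.
      - rewrite Epi_const; apply Rmult_le_pos; [|apply Hpos].
        apply Rmult_le_pos; [generalize (Hc lo); lra | lra]. }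
    rewrite sumL_scal in HR, HL.
    assert (HS := Hsuper t ltac:(unfold t in *; lia)).
    apply Rle_trans with (origin_cost lo * (2 * q * sumL (fun j => h (t + j)%nat) (seq 1 t))).
    + lra.
    + apply Rmult_le_compat_l; [generalize (Hc lo); lra | exact HS].
Qed.

(** Crossing a shell sums a [k]-th power, which yields [2^(k + 1) / (k + 1)]; iterating produces the
    binomial exponent and the factorial. Using [4 q] instead of [2 q] leaves half of the bound for
    steps inside a shell. *)
Definition chain_coef (k : nat) : R := (4 * q) ^ k * 2 ^ choose2 (S k) / INR (fact k).

(** The exponent counts the dyadic shells still to cross; truncated subtraction makes the bound 1
    once [t >= 2^kappa]. *)
Definition chain_bound (kappa t : nat) : R :=
  chain_coef (kappa - Nat.log2 t) * (INR t + 1) ^ (kappa - Nat.log2 t).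

Lemma chain_coef_pos k : 0 < chain_coef k.
Proof.
  unfold chain_coef; apply Rdiv_lt_0_compat; [|apply lt_0_INR, lt_O_fact].
  apply Rmult_lt_0_compat; apply pow_lt; lra.
Qed.

Lemma chain_coef_S k :
  2 * q * (chain_coef k * (2 ^ S k / INR (S k))) = / 2 * chain_coef (S k).
Proof.
  unfold chain_coef; rewrite (choose2_S (S k)), pow_add, fact_simpl, mult_INR.
  cbn [pow]; field; split; first [apply INR_fact_neq_0 | apply not_0_INR; lia].
Qed.

(** Discrete form of integrating [(p + 1) u^p] over a unit interval; summing it telescopes. *)
Lemma pow_step_le p u : 0 <= u -> INR (S p) * u ^ p <= (u + 1) ^ S p - u ^ S p.
Proof.
  intros Hu; induction p as [|p IH]; [simpl; lra|].
  rewrite S_INR; cbn [pow] in *.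
  assert (u ^ p <= (u + 1) ^ p) by (apply pow_incr; lra).
  set (A := u ^ p) in *; set (B := (u + 1) ^ p) in *.
  assert (0 <= A) by (unfold A; apply pow_le; lra).
  set (c := INR (S p)) in *.
  assert (c * A * u <= ((u + 1) * B - u * A) * u) by (apply Rmult_le_compat_r; lra).
  nra.
Qed.

Lemma sum_pow_le p y a m : 0 <= y ->
  INR (S p) * sumL (fun j => (y + INR j) ^ p) (seq a m)
  <= (y + INR (a + m)) ^ S p - (y + INR a) ^ S p.
Proof.
  intros Hy; revert a; induction m as [|m IH]; intros a.
  - simpl seq; rewrite Nat.add_0_r; unfold sumL; simpl fold_right; lra.
  - cbn [seq]; change (sumL ?F (a :: ?l)) with (F a + sumL F l).
    specialize (IH (S a)); replace (S a + m)%nat with (a + S m)%nat in IH by lia.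
    assert (H := pow_step_le p (y + INR a)).
    replace (y + INR a + 1) with (y + INR (S a)) in H by (rewrite S_INR; ring).
    assert (0 <= INR a) by apply pos_INR.
    specialize (H ltac:(lra)); lra.
Qed.

(* In the dyadic shell [2^l <= t < 2^(l+1)], with [k = kappa - l], steps that
   stay in the shell contribute at most [4 q 2^kappa <= 1/2] of the bound and
   steps to the next shell the other half. *)
Lemma chain_bound_super kappa t : (1 <= t < 2 ^ kappa)%nat -> 8 * q * 2 ^ kappa <= 1 ->
  2 * q * sumL (fun j => chain_bound kappa (t + j)) (seq 1 t) <= chain_bound kappa t.
Proof.
  intros [Ht1 Ht2] Hk.
  destruct (Nat.log2_spec t ltac:(lia)) as [Hl1 Hl2].
  set (l := Nat.log2 t) in *.
  assert (Hlk : (l < kappa)%nat).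
  { apply (Nat.pow_lt_mono_r_iff 2); lia. }
  unfold chain_bound at 2; fold l.
  destruct (kappa - l)%nat as [|k] eqn:Ek; [lia|].
  assert (HT : 0 <= INR t) by apply pos_INR.
  assert (Hterm : forall j, In j (seq 1 t) -> chain_bound kappa (t + j) <=
      chain_coef (S k) * (2 * (INR t + 1)) ^ S k
      + chain_coef k * ((INR t + 1) + INR j) ^ k).
  { intros j Hj; apply in_seq in Hj.
    assert (Hj1 : INR j <= INR t) by (apply le_INR; lia).
    assert (Hj0 : 0 <= INR j) by apply pos_INR.
    assert (H1 : 0 <= chain_coef k * ((INR t + 1) + INR j) ^ k).
    { apply Rmult_le_pos; [apply Rlt_le, chain_coef_pos | apply pow_le; lra]. }
    assert (H2 : 0 <= chain_coef (S k) * (2 * (INR t + 1)) ^ S k).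
    { apply Rmult_le_pos; [apply Rlt_le, chain_coef_pos | apply pow_le; lra]. }
    assert (Hlog : Nat.log2 (t + j) = l \/ Nat.log2 (t + j) = S l).
    { assert (l <= Nat.log2 (t + j))%nat by (apply Nat.log2_le_mono; lia).
      assert (Nat.log2 (t + j) < S (S l))%nat.
      { apply Nat.log2_lt_pow2; [lia|]. rewrite Nat.pow_succ_r'; lia. }
      lia. }
    unfold chain_bound; rewrite plus_INR.
    destruct Hlog as [-> | ->].
    - rewrite Ek; apply Rle_trans with (chain_coef (S k) * (2 * (INR t + 1)) ^ S k); [|lra].
      apply Rmult_le_compat_l; [apply Rlt_le, chain_coef_pos|]. apply pow_incr; lra.
    - replace (kappa - S l)%nat with k by lia.
      replace (INR t + INR j + 1) with (INR t + 1 + INR j) by ring; lra. }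
  apply Rle_trans with (2 * q * sumL (fun j => chain_coef (S k) * (2 * (INR t + 1)) ^ S k
      + chain_coef k * ((INR t + 1) + INR j) ^ k) (seq 1 t)).
  { apply Rmult_le_compat_l; [lra | now apply sumL_le]. }
  rewrite sumL_plus, sumL_const, sumL_scal, length_seq.
  assert (Hpow : 0 < (INR t + 1) ^ S k) by (apply pow_lt; lra).
  assert (HcS := chain_coef_pos (S k)); assert (Hck := chain_coef_pos k).
  assert (A1 : 2 * q * (INR t * (chain_coef (S k) * (2 * (INR t + 1)) ^ S k))
               <= / 2 * (chain_coef (S k) * (INR t + 1) ^ S k)).
  { rewrite Rpow_mult_distr.
    replace (2 * q * (INR t * (chain_coef (S k) * (2 ^ S k * (INR t + 1) ^ S k))))
      with (2 * q * (INR t * 2 ^ S k) * (chain_coef (S k) * (INR t + 1) ^ S k)) by ring.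
    apply Rmult_le_compat_r; [apply Rlt_le, Rmult_lt_0_compat; lra|].
    assert (Hp : 0 < 2 ^ S k) by (apply pow_lt; lra).
    assert (Ht : INR t <= 2 * 2 ^ l).
    { change (2 * 2 ^ l) with (2 ^ S l); replace 2 with (INR 2) by reflexivity.
      rewrite <- pow_INR; apply le_INR; lia. }
    assert (E : 2 ^ kappa = 2 ^ l * 2 ^ S k) by (rewrite <- pow_add; f_equal; lia).
    assert (INR t * 2 ^ S k <= 2 * 2 ^ kappa).
    { rewrite E, <- Rmult_assoc; apply Rmult_le_compat_r; lra. }
    nra. }
  assert (A2 : 2 * q * (chain_coef k * sumL (fun j => ((INR t + 1) + INR j) ^ k) (seq 1 t))
               <= / 2 * (chain_coef (S k) * (INR t + 1) ^ S k)).
  { assert (Hs := sum_pow_le k (INR t + 1) 1 t ltac:(lra)).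
    assert (0 <= (INR t + 1 + INR 1) ^ S k) by (apply pow_le; simpl; lra).
    replace (INR t + 1 + INR (1 + t)) with (2 * (INR t + 1)) in Hs
      by (rewrite plus_INR; simpl; ring).
    rewrite Rpow_mult_distr in Hs.
    rewrite <- (Rmult_assoc (/ 2)), <- chain_coef_S.
    assert (HSk : 0 < INR (S k)) by (apply lt_0_INR; lia).
    set (Sg := sumL _ _) in *.
    assert (Sg <= 2 ^ S k / INR (S k) * (INR t + 1) ^ S k).
    { apply Rmult_le_reg_l with (INR (S k)); [exact HSk|].
      replace (INR (S k) * (2 ^ S k / INR (S k) * (INR t + 1) ^ S k))
        with (2 ^ S k * (INR t + 1) ^ S k) by (field; lra). lra. }
    replace (2 * q * (chain_coef k * (2 ^ S k / INR (S k))) * (INR t + 1) ^ S k)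
      with (2 * q * (chain_coef k * (2 ^ S k / INR (S k) * (INR t + 1) ^ S k))) by ring.
    apply Rmult_le_compat_l; [lra|]. apply Rmult_le_compat_l; lra. }
  lra.
Qed.

(** The factor [1 / q] bounds the origin cost. The implication form admits [kappa = 0], where [8 q]
    may exceed 1. *)
Lemma expected_chains_bound kappa n fuel i : (kappa <> 0%nat -> 8 * q * 2 ^ kappa <= 1) ->
  Epi q n (chains (2 ^ kappa) fuel i (S i)) <= / q * (chain_coef kappa * 2 ^ kappa).
Proof.
  intros Hk.
  assert (Hpos : forall t, 0 < chain_bound kappa t).
  { intros t; unfold chain_bound; apply Rmult_lt_0_compat; [apply chain_coef_pos|].
    apply pow_lt; generalize (pos_INR t); lra. }
  assert (H1 : chain_bound kappa 1 = chain_coef kappa * 2 ^ kappa).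
  { unfold chain_bound; rewrite Nat.log2_1, Nat.sub_0_r; simpl (INR 1).
    replace (1 + 1) with 2 by ring; reflexivity. }
  rewrite <- H1.
  apply Rle_trans with (origin_cost i * chain_bound kappa (S i - i)%nat).
  - apply expected_chains_le; [intros; now apply Rlt_le | | | lia].
    + intros t Ht; unfold chain_bound.
      assert (kappa <= Nat.log2 t)%nat.
      { apply Nat.log2_le_pow2; [|exact Ht]. generalize (Nat.pow_nonzero 2 kappa); lia. }
      replace (kappa - Nat.log2 t)%nat with 0%nat by lia.
      unfold chain_coef; simpl; lra.
    + intros t Ht; apply chain_bound_super; [exact Ht|]. apply Hk; intros ->; simpl in Ht; lia.
  - replace (S i - i)%nat with 1%nat by lia.
    apply Rmult_le_compat_r; [now apply Rlt_le|].
    assert (1 <= / q) by (rewrite <- Rinv_1 at 1; apply Rinv_le_contravar; lra).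
    destruct i; simpl; lra.
Qed.
End ExpectedChains.

(** * The bottleneck and the spectral gap *)

Definition long_lived (T : nat) (s : list bool) : R :=
  if existsb (fun v => T <=? life (zero_at s) (length s) v)%nat (seq 1 (length s)) then 1 else 0.

Lemma zero_at_le_length s v : zero_at s v = true -> (v <= length s)%nat.
Proof.
  destruct v as [|i]; simpl; [lia|]; intros H.
  destruct (le_lt_dec (length s) i) as [Hle|]; [|lia].
  now rewrite nth_overflow in H.
Qed.

Lemma life_zero_at s : is_lifetime (zero_at s) (length s) (life (zero_at s) (length s)).
Proof. apply life_is_lifetime, zero_at_le_length. Qed.

Lemma long_lived_iff T s :
  long_lived T s = 1 <->
  exists v, (1 <= v <= length s)%nat /\ (T <= life (zero_at s) (length s) v)%nat.
Proof.
  unfold long_lived.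
  destruct (existsb _ _) eqn:E; split; intros H.
  - apply existsb_exists in E; destruct E as (v & Hv & Hl).
    apply in_seq in Hv; apply Nat.leb_le in Hl; exists v; split; [lia | exact Hl].
  - reflexivity.
  - lra.
  - destruct H as (v & Hv & Hl).
    rewrite <- Bool.not_true_iff_false in E; destruct E; apply existsb_exists.
    exists v; split; [apply in_seq; lia | now apply Nat.leb_le].
Qed.

Lemma long_lived_values T s : long_lived T s = 0 \/ long_lived T s = 1.
Proof. unfold long_lived; destruct (existsb _ _); auto. Qed.

(** Each growth step is one term of a sum of nonnegative terms. Induction peels off the last step,
    so the fuel must be arbitrary. *)
Lemma grows_chains T s a b k lo hi : grows (zero_at s) a b k lo hi ->
  forall fuel, 1 <= chains T fuel lo hi s -> 1 <= chains T (k + fuel) a b s.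
Proof.
  intros Hg; induction Hg as [|k lo hi j Hg IH H1 H2 Hz|k lo hi j Hg IH H1 H2 H3 Hz];
    intros fuel Hf; [exact Hf| |].
  - replace (S k + fuel)%nat with (k + S fuel)%nat by lia; apply IH.
    cbn [chains]; destruct (T <=? hi - lo)%nat; [lra|].
    assert (Ht := sumL_ge_term (fun j => zero_ind s (hi + j) * chains T fuel lo (hi + j) s)
      (seq 1 (hi - lo)) j
      (fun j _ => Rmult_le_pos _ _ (zero_ind_nonneg s _) (chains_nonneg _ _ _ _ _))
      ltac:(apply in_seq; lia)).
    cbv beta in Ht; unfold zero_ind at 1 in Ht; rewrite Hz in Ht.
    assert (0 <= sumL (fun j => if (j <=? lo)%nat
      then zero_ind s (lo - j) * chains T fuel (lo - j) hi s else 0) (seq 1 (hi - lo))).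
    { apply sumL_nonneg; intros i _; destruct (i <=? lo)%nat; [|lra].
      apply Rmult_le_pos; [apply zero_ind_nonneg | apply chains_nonneg]. }
    lra.
  - replace (S k + fuel)%nat with (k + S fuel)%nat by lia; apply IH.
    cbn [chains]; destruct (T <=? hi - lo)%nat; [lra|].
    assert (Ht := sumL_ge_term (fun j => if (j <=? lo)%nat
        then zero_ind s (lo - j) * chains T fuel (lo - j) hi s else 0) (seq 1 (hi - lo)) j).
    cbv beta in Ht; rewrite (proj2 (Nat.leb_le j lo) H3) in Ht.
    unfold zero_ind at 2 in Ht; rewrite Hz in Ht.
    assert (0 <= sumL (fun j => zero_ind s (hi + j) * chains T fuel lo (hi + j) s) (seq 1 (hi - lo))).
    { apply sumL_nonneg; intros i _.
      apply Rmult_le_pos; [apply zero_ind_nonneg | apply chains_nonneg]. }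
    assert (1 * chains T fuel (lo - j) hi s <= sumL (fun j => if (j <=? lo)%nat
        then zero_ind s (lo - j) * chains T fuel (lo - j) hi s else 0) (seq 1 (hi - lo))).
    { apply Ht; [|apply in_seq; lia].
      intros i _; destruct (i <=? lo)%nat; [|lra].
      apply Rmult_le_pos; [apply zero_ind_nonneg | apply chains_nonneg]. }
    lra.
Qed.

(** A change of the indicator gives a site whose lifetime is at least [T] in exactly one of the two
    states; the discrepancy there yields an interval of length at least [T] grown from
    [[i, i + 1]]. *)
Lemma long_lived_flip T s i :
  (i < length s)%nat -> zero_at s i = true ->
  long_lived T (upd i true s) <> long_lived T (upd i false s) ->
  1 <= chains T (length s) i (S i) s.
Proof.
  intros Hi Hz Hne; set (L := length s).
  set (life_of := fun b => life (zero_at (upd i b s)) L).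
  assert (Hagree : forall b, agrees_off_x (S i) L (zero_at s) (zero_at (upd i b s))).
  { intros b; split; [intros; now apply zero_at_upd_other|].
    intros v Hv; apply zero_at_le_length in Hv; now rewrite upd_length in Hv. }
  assert (Hlife : forall b, is_lifetime (zero_at (upd i b s)) L (life_of b)).
  { intros b; unfold life_of; rewrite <- (upd_length i b s : _ = L); apply life_zero_at. }
  assert (Hiff : forall b, long_lived T (upd i b s) = 1 <->
    exists v, (1 <= v <= L)%nat /\ (T <= life_of b v)%nat).
  { intros b; rewrite long_lived_iff, upd_length; reflexivity. }
  assert (Hv : exists v, (v <= L)%nat /\ life_of true v <> life_of false v /\
            (T <= life_of true v \/ T <= life_of false v)%nat).
  { assert (K : forall b, long_lived T (upd i b s) = 1 -> long_lived T (upd i (negb b) s) <> 1 ->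
      exists v, (v <= L)%nat /\ (T <= life_of b v)%nat /\ (life_of (negb b) v < T)%nat).
    { intros b H1 H2; apply Hiff in H1; destruct H1 as (v & Hv & Hl).
      exists v; repeat split; [lia | exact Hl|].
      destruct (le_lt_dec T (life_of (negb b) v)) as [Hle|]; [|assumption].
      destruct H2; apply Hiff; eauto. }
    destruct (long_lived_values T (upd i true s)) as [Et|Et];
      destruct (long_lived_values T (upd i false s)) as [Ef|Ef]; try lra.
    - destruct (K false) as (v & H1 & H2 & H3); simpl; try lra; simpl in H3.
      exists v; repeat split; lia.
    - destruct (K true) as (v & H1 & H2 & H3); simpl; try lra; simpl in H3.
      exists v; repeat split; lia. }
  destruct Hv as (v & HvL & Hd & HT).
  assert (Hpred : zero_at s (S i - 1) = true) by (now rewrite Nat.sub_succ, Nat.sub_0_r).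
  destruct (discrepancy_grows (S i) L (zero_at s) ltac:(lia) eq_refl Hpred
    _ _ _ _ v (Hagree true) (Hagree false) (Hlife true) (Hlife false)
    ltac:(unfold L; lia) Hd) as (k & lo & Hg & L1 & L2).
  rewrite Nat.sub_succ, Nat.sub_0_r in Hg.
  destruct (grows_bounds _ _ _ _ _ _ (Nat.le_succ_diag_r i) Hg) as (_ & _ & Hk).
  (* Each step gains length inside [[0, L]], so [k <= L] and fuel [L] suffices. *)
  replace L with (k + (L - k))%nat by lia.
  apply (grows_chains T s i (S i) k lo v Hg).
  assert (Hlen : (T <=? v - lo)%nat = true) by (apply Nat.leb_le; lia).
  destruct (L - k)%nat; cbn [chains]; rewrite Hlen; lra.
Qed.

(** At each site the local variance is at most 1 and vanishes unless a legal flip changes the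
    indicator, in which case [chains] is at least 1. *)
Lemma Dirichlet_long_lived_le q kappa L :
  0 < q -> q < 1 -> (kappa <> 0%nat -> 8 * q * 2 ^ kappa <= 1) ->
  Dirichlet q L (long_lived (2 ^ kappa)) <= INR L * (/ q * (chain_coef q kappa * 2 ^ kappa)).
Proof.
  intros Hq Hq1 Hk; unfold Dirichlet.
  rewrite <- (length_seq L 0) at 2; rewrite <- sumL_const.
  apply sumL_le; intros i Hi; apply in_seq in Hi.
  apply Rle_trans with (2 := expected_chains_bound q Hq Hq1 kappa L L i Hk).
  apply Epi_le; trivial; intros s Hs.
  assert (Hn := chains_nonneg (2 ^ kappa) L i (S i) s).
  assert (Hc : cEast i s = 0 \/ cEast i s = 1 /\ zero_at s i = true).
  { destruct i as [|i]; simpl; [auto|].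
    rewrite (nth_indep s false true) by lia; destruct (nth i s true); auto. }
  destruct Hc as [-> | [-> Hz]]; [lra|].
  rewrite Rmult_1_l, Varx_eq.
  destruct (Req_dec (long_lived (2 ^ kappa) (upd i true s)) (long_lived (2 ^ kappa) (upd i false s)))
    as [E|E].
  - rewrite E, Rminus_diag; lra.
  - assert (H1 := long_lived_flip (2 ^ kappa) s i ltac:(lia) Hz E); rewrite Hs in H1.
    apply Rle_trans with (2 := H1).
    destruct (long_lived_values (2 ^ kappa) (upd i true s)) as [-> | ->];
      destruct (long_lived_values (2 ^ kappa) (upd i false s)) as [-> | ->]; nra.
Qed.

Lemma long_lived_ones T L : (1 <= T)%nat -> long_lived T (repeat true L) = 0.
Proof.
  intros HT; destruct (long_lived_values T (repeat true L)) as [|H]; [assumption|exfalso].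
  apply long_lived_iff in H; destruct H as (v & Hv & Hl).
  destruct (life_zero_at (repeat true L)) as [_ TS].
  destruct (TS v ltac:(lia)) as [T1 _].
  rewrite T1 in Hl; [lia|].
  destruct v as [|i]; [lia|]; simpl.
  assert (E : nth i (repeat true L) true = true) by apply nth_repeat.
  now rewrite E.
Qed.

(** The only possible parent of the single zero is the origin, at distance [S l]. *)
Lemma long_lived_last_zero T l : (T <= S l)%nat -> long_lived T (repeat true l ++ [false]) = 1.
Proof.
  intros HT; set (s := repeat true l ++ [false]).
  assert (Hs : length s = S l) by (unfold s; rewrite length_app, repeat_length; simpl; lia).
  assert (Hz : zero_at s (S l) = true).
  { simpl; unfold s; rewrite app_nth2, repeat_length, Nat.sub_diag by (rewrite repeat_length; lia).
    reflexivity. }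
  assert (Hnz : forall v, (1 <= v <= l)%nat -> zero_at s v = false).
  { intros [|i] Hv; [lia|]; simpl; unfold s.
    rewrite app_nth1 by (rewrite repeat_length; lia).
    assert (E : nth i (repeat true l) true = true) by apply nth_repeat.
    now rewrite E. }
  apply long_lived_iff; exists (S l); split; [lia|].
  destruct (life_zero_at s) as [_ TS]; set (life_s := life (zero_at s) (length s)) in *.
  destruct (TS (S l) ltac:(lia)) as [_ T2]; destruct (T2 Hz) as (H1 & H2 & _).
  set (p := (S l - life_s (S l))%nat) in *.
  destruct (Nat.eq_dec p 0) as [E|E]; [lia|exfalso].
  destruct (TS p ltac:(lia)) as [T1 _].
  specialize (T1 (Hnz p ltac:(lia))); lia.
Qed.

Lemma pi_conf_ones q L : pi_conf q (repeat true L) = (1 - q) ^ L.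
Proof. induction L as [|L IH]; simpl; [reflexivity | now rewrite IH]. Qed.

Lemma pi_conf_last_zero q l : pi_conf q (repeat true l ++ [false]) = (1 - q) ^ l * q.
Proof. induction l as [|l IH]; simpl; [ring | rewrite IH; ring]. Qed.

(** An indicator of mean [m] has variance [m (1 - m)]; the atom with one zero at the end bounds [m]
    from below, the atom of all ones bounds [1 - m]. *)
Lemma Varpi_long_lived_ge q T L : 0 < q -> q < 1 -> (1 <= T <= L)%nat ->
  q * ((1 - q) ^ L * (1 - q) ^ L) <= Varpi q L (long_lived T).
Proof.
  intros Hq Hq1 HT; set (f := long_lived T).
  destruct L as [|l]; [lia|].
  assert (Hone : (1 - q) ^ S l <= 1 - Epi q (S l) f).
  { replace (1 - Epi q (S l) f) with (Epi q (S l) (fun s => 1 - f s))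
      by (rewrite Epi_minus, Epi_const; reflexivity).
    assert (H := Epi_ge_atom q Hq Hq1 (S l) (fun s => 1 - f s) (repeat true (S l))).
    rewrite pi_conf_ones in H; unfold f at 2 in H; rewrite long_lived_ones in H by lia.
    apply Rle_trans with (2 := H ltac:(intros; unfold f; destruct (long_lived_values T t); lra)
      (repeat_length _ _)); lra. }
  assert (Hlast : (1 - q) ^ l * q <= Epi q (S l) f).
  { assert (H := Epi_ge_atom q Hq Hq1 (S l) f (repeat true l ++ [false])).
    rewrite pi_conf_last_zero in H; unfold f at 2 in H; rewrite long_lived_last_zero in H by lia.
    rewrite Rmult_1_r in H; apply H.
    - intros; unfold f; destruct (long_lived_values T t); lra.
    - rewrite length_app, repeat_length; simpl; lia. }
  replace (Varpi q (S l) f) with (Epi q (S l) f * (1 - Epi q (S l) f)).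
  2:{ unfold Varpi. rewrite (Epi_ext q (S l) (fun s => f s * f s) f); [ring|].
      intros; unfold f; destruct (long_lived_values T s) as [-> | ->]; ring. }
  assert (0 < (1 - q) ^ l) by (apply pow_lt; lra).
  assert (0 < (1 - q) ^ S l) by (apply pow_lt; lra).
  apply Rle_trans with (((1 - q) ^ l * q) * (1 - q) ^ S l).
  - rewrite <- Rmult_assoc; apply Rmult_le_compat_r; [lra|].
    rewrite (Rmult_comm ((1 - q) ^ l)); apply Rmult_le_compat_l; [lra|]. simpl; nra.
  - apply Rmult_le_compat; try lra; apply Rmult_le_pos; lra.
Qed.

(** * Absorption of constants into powers of [1 / q] *)

Lemma inv_pow_one_minus_le q d L : 0 < q -> q < 1 / 2 -> INR L <= d / q ->
  / ((1 - q) ^ L * (1 - q) ^ L) <= exp (4 * d).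
Proof.
  intros Hq Hq2 HL.
  assert (Hp : 0 < (1 - q) ^ L) by (apply pow_lt; lra).
  assert (H : / (1 - q) ^ L <= exp (2 * d)).
  { rewrite <- pow_inv.
    apply Rle_trans with (exp (2 * q) ^ L).
    - apply pow_incr; split; [apply Rlt_le, Rinv_0_lt_compat; lra|].
      (* For [q <= 1/2], [(1 + 2 q) (1 - q) >= 1]. *)
      apply Rle_trans with (1 + 2 * q); [|apply exp_ineq1_le].
      apply Rmult_le_reg_r with (1 - q); [lra|]. rewrite Rinv_l by lra; nra.
    - rewrite exp_pow_INR.
      assert (Hle : INR L * (2 * q) <= 2 * d).
      { apply Rle_trans with (d / q * (2 * q)); [apply Rmult_le_compat_r; lra | right; field; lra]. }
      destruct (Rle_lt_or_eq_dec _ _ Hle) as [Hlt| ->]; [|lra].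
      apply Rlt_le, exp_increasing, Hlt. }
  rewrite Rinv_mult; replace (4 * d) with (2 * d + 2 * d) by ring; rewrite exp_plus.
  assert (0 < / (1 - q) ^ L) by (apply Rinv_0_lt_compat; lra).
  apply Rmult_le_compat; lra.
Qed.

Lemma Rinv_east_scale q n : 0 < q ->
  / east_scale q n = q ^ n * 2 ^ choose2 n / INR (fact n).
Proof.
  intros Hq; unfold east_scale.
  assert (0 < q ^ n) by (apply pow_lt; lra).
  assert (0 < 2 ^ choose2 n) by (apply pow_lt; lra).
  field; repeat split; try lra; apply INR_fact_neq_0.
Qed.

Lemma east_scale_pos q n : 0 < q -> 0 < east_scale q n.
Proof.
  intros Hq; unfold east_scale; apply Rdiv_lt_0_compat; [apply lt_0_INR, lt_O_fact|].
  apply Rmult_lt_0_compat; apply pow_lt; lra.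
Qed.

(** Going up one scale multiplies the inverse by [q 2^n / (n + 1)], which is at least [q]. *)
Lemma Rinv_east_scale_add q k m : 0 < q ->
  / east_scale q k <= (/ q) ^ m * / east_scale q (k + m).
Proof.
  intros Hq; induction m as [|m IH]; [rewrite Nat.add_0_r; simpl; lra|].
  apply Rle_trans with (1 := IH).
  replace (k + S m)%nat with (S (k + m)) by lia; set (n := (k + m)%nat).
  rewrite !Rinv_east_scale by exact Hq.
  rewrite choose2_S, fact_simpl, mult_INR, pow_add; cbn [pow].
  assert (Hn : INR (S n) <= 2 ^ n).
  { rewrite <- (pow_INR 2 n : INR (2 ^ n) = 2 ^ n); apply le_INR.
    generalize (Nat.pow_gt_lin_r 2 n); lia. }
  assert (HS : 0 < INR (S n)) by (apply lt_0_INR; lia).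
  assert (Hf : 0 < INR (fact n)) by (apply lt_0_INR, lt_O_fact).
  assert (0 < q ^ n) by (apply pow_lt; lra).
  assert (0 < 2 ^ choose2 n) by (apply pow_lt; lra).
  assert (0 < (/ q) ^ m) by (apply pow_lt, Rinv_0_lt_compat; lra).
  replace (/ q * (/ q) ^ m * (q * q ^ n * (2 ^ choose2 n * 2 ^ n) / (INR (S n) * INR (fact n))))
    with ((/ q) ^ m * (q ^ n * 2 ^ choose2 n / INR (fact n)) * (2 ^ n / INR (S n)))
    by (field; repeat split; lra).
  assert (1 <= 2 ^ n / INR (S n)).
  { apply Rmult_le_reg_r with (INR (S n)); [exact HS|].
    unfold Rdiv; rewrite Rmult_assoc, Rinv_l by lra; lra. }
  rewrite <- (Rmult_1_r ((/ q) ^ m * (q ^ n * 2 ^ choose2 n / INR (fact n)))) at 1.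
  apply Rmult_le_compat_l; [|assumption].
  apply Rmult_le_pos; [lra|]. apply Rlt_le, Rdiv_lt_0_compat; [|lra].
  now apply Rmult_lt_0_compat.
Qed.

Lemma chain_coef_east_scale q k : 0 < q ->
  chain_coef q k * 2 ^ k = (2 ^ k) ^ 4 * / east_scale q k.
Proof.
  intros Hq; rewrite Rinv_east_scale by exact Hq; unfold chain_coef.
  rewrite choose2_S, pow_add, Rpow_mult_distr.
  replace 4 with (2 * 2) by ring; rewrite Rpow_mult_distr.
  field; apply INR_fact_neq_0.
Qed.

Lemma Dirichlet_upper_bound d : 0 < d -> exists a : nat, (1 <= a)%nat /\
  forall q L, 0 < q -> q < 1 / 2 -> (1 <= L)%nat -> INR L <= d / q ->
  exists f, nonconstant L f /\
    Dirichlet q L f / Varpi q L f <= (/ q) ^ a * / east_scale q (Nat.log2_up L).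
Proof.
  intros Hd.
  destruct (exists_pow2_ge d) as [r Hr].
  destruct (exists_pow2_ge (exp (4 * d))) as [e He].
  destruct (exists_pow2_ge (16 * d)) as [m0 Hm0].
  (* From [2^n <= 2 d / q], [2^m >= 16 d] gives [8 q 2^kappa <= 1]; for [n > 0], [m >= 1] gives
     [2^kappa <= 2^(n - 1) <= L]. *)
  set (m := S m0).
  (* In order: the number of sites, the origin cost, the factor [q] in the variance, [exp (4 d)],
     the factor [(2^kappa)^4], and the passage from scale [kappa] to [n]. *)
  exists ((r + 1) + (1 + (1 + (e + ((r + 1) * 4 + m)))))%nat; split; [lia|].
  intros q L Hq Hq2 HL HLd.
  destruct (pow2_log2_up_bounds L HL) as [Ha Hb].
  set (n := Nat.log2_up L) in *.
  set (kappa := (n - m)%nat).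
  set (Q := / q).
  assert (HqQ : q * Q = 1) by (unfold Q; field; lra).
  assert (HQ : 2 < Q).
  { unfold Q; replace 2 with (/ (1 / 2)) by lra; apply Rinv_lt_contravar; nra. }
  assert (HLQ : INR L <= Q ^ (r + 1)).
  { apply Rle_trans with (1 := HLd); rewrite pow_add, pow_1.
    apply Rmult_le_compat_r; [fold Q; lra|].
    apply Rle_trans with (1 := Hr); apply pow_incr; lra. }
  assert (Hm : 16 * d <= 2 ^ m).
  { apply Rle_trans with (1 := Hm0); apply Rle_pow; [lra | unfold m; lia]. }
  assert (Hk : kappa <> 0%nat -> 8 * q * 2 ^ kappa <= 1).
  { intros Hk0.
    assert (E : 2 ^ n = 2 ^ kappa * 2 ^ m) by (rewrite <- pow_add; f_equal; unfold kappa in *; lia).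
    assert (H1 : q * 2 ^ n <= 2 * d).
    { apply Rle_trans with (q * (2 * (d / q))); [|right; field; lra].
      apply Rmult_le_compat_l; lra. }
    rewrite E in H1.
    assert (0 < 2 ^ kappa) by (apply pow_lt; lra).
    apply Rmult_le_reg_r with (2 * d); [lra|].
    assert (0 < q * 2 ^ kappa) by (apply Rmult_lt_0_compat; lra).
    assert (q * 2 ^ kappa * (16 * d) <= q * 2 ^ kappa * 2 ^ m) by (apply Rmult_le_compat_l; lra).
    lra. }
  assert (HkL : (1 <= 2 ^ kappa <= L)%nat).
  { split; [generalize (Nat.pow_nonzero 2 kappa); lia|].
    apply INR_le; rewrite pow_INR; change (INR 2) with 2.
    destruct n as [|n'] eqn:En.
    - unfold kappa; simpl; apply (le_INR 1); lia.
    - apply Rle_trans with (2 ^ n'); [apply Rle_pow; [lra | unfold kappa, m; lia]|].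
      simpl in Hb; lra. }
  set (f := long_lived (2 ^ kappa)).
  exists f; split.
  { destruct L as [|l]; [lia|].
    exists (repeat true (S l)), (repeat true l ++ [false]); repeat split.
    - apply In_configs, repeat_length.
    - apply In_configs; rewrite length_app, repeat_length; simpl; lia.
    - unfold f; rewrite long_lived_ones, long_lived_last_zero by lia; lra. }
  assert (HD := Dirichlet_long_lived_le q kappa L Hq ltac:(lra) Hk).
  assert (HV := Varpi_long_lived_ge q (2 ^ kappa) L Hq ltac:(lra) HkL).
  fold f in HD, HV.
  assert (Hexp := inv_pow_one_minus_le q d L Hq Hq2 HLd).
  set (P := (1 - q) ^ L * (1 - q) ^ L) in *.
  assert (HP : 0 < P) by (unfold P; apply Rmult_lt_0_compat; apply pow_lt; lra).
  assert (HPe : / P <= Q ^ e).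
  { apply Rle_trans with (1 := Hexp), Rle_trans with (1 := He), pow_incr; lra. }
  assert (HqP : 0 < q * P) by (now apply Rmult_lt_0_compat).
  rewrite chain_coef_east_scale in HD by exact Hq; fold Q in HD.
  assert (H4 : (2 ^ kappa) ^ 4 <= Q ^ ((r + 1) * 4)).
  { rewrite pow_mult; apply pow_incr; split; [apply pow_le; lra|].
    apply Rle_trans with (2 := HLQ); rewrite <- (pow_INR 2 kappa : INR (2 ^ kappa) = 2 ^ kappa).
    apply le_INR; lia. }
  assert (Hsc : / east_scale q kappa <= Q ^ m * / east_scale q n).
  { destruct (le_lt_dec m n) as [Hmn|Hmn].
    - replace n with (kappa + m)%nat by (unfold kappa; lia); now apply Rinv_east_scale_add.
    - replace kappa with 0%nat by (unfold kappa; lia).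
      apply Rle_trans with (1 := Rinv_east_scale_add q 0 n Hq).
      apply Rmult_le_compat_r; [apply Rlt_le, Rinv_0_lt_compat, east_scale_pos; lra|].
      apply Rle_pow; [fold Q; lra | lia]. }
  assert (Hi1 : 0 < / east_scale q kappa) by (now apply Rinv_0_lt_compat, east_scale_pos).
  assert (Hi2 : 0 < / east_scale q n) by (now apply Rinv_0_lt_compat, east_scale_pos).
  assert (HD0 : 0 <= Dirichlet q L f) by (rewrite Dirichlet_east_form; apply east_form_nonneg; lra).
  assert (HQp : forall k, 0 < Q ^ k) by (intros; apply pow_lt; lra).
  assert (HDQ : Dirichlet q L f <=
      Q ^ (r + 1) * (Q * (Q ^ ((r + 1) * 4) * (Q ^ m * / east_scale q n)))).
  { apply Rle_trans with (1 := HD).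
    assert (0 <= (2 ^ kappa) ^ 4) by (apply pow_le, pow_le; lra).
    apply Rmult_le_compat; [apply pos_INR | | exact HLQ |].
    - apply Rmult_le_pos; [lra|]. apply Rmult_le_pos; lra.
    - apply Rmult_le_compat_l; [lra|]. apply Rmult_le_compat; lra. }
  apply Rle_trans with (Dirichlet q L f * (Q * Q ^ e)).
  - unfold Rdiv; apply Rmult_le_compat_l; [exact HD0|].
    apply Rle_trans with (/ (q * P)); [apply Rinv_le_contravar; lra|].
    rewrite Rinv_mult; fold Q; apply Rmult_le_compat_l; lra.
  - rewrite !pow_add, pow_1.
    apply Rle_trans with (Q ^ (r + 1) * (Q * (Q ^ ((r + 1) * 4) * (Q ^ m * / east_scale q n)))
      * (Q * Q ^ e)).
    + apply Rmult_le_compat_r; [|exact HDQ]. apply Rlt_le, Rmult_lt_0_compat; [lra | apply HQp].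
    + right; rewrite pow_add, pow_1; ring.
Qed.

(** * Existence of the gap and conclusion *)

Lemma spectral_gap_exists q L : 0 < q -> q < 1 -> (1 <= L)%nat -> exists g, is_spectral_gap q L g.
Proof.
  intros Hq Hq1 HL.
  (* Negating the quotients turns the infimum into a supremum, bounded above by 0. *)
  set (E := fun x => exists f, nonconstant L f /\ x = - (Dirichlet q L f / Varpi q L f)).
  destruct (completeness E) as [M [HM1 HM2]].
  - exists 0; intros x (f & Hf & ->).
    assert (0 < Varpi q L f) by now apply Varpi_pos.
    assert (0 <= Dirichlet q L f) by (rewrite Dirichlet_east_form; now apply east_form_nonneg).
    assert (0 <= Dirichlet q L f / Varpi q L f)
      by (apply Rmult_le_pos; [lra | apply Rlt_le, Rinv_0_lt_compat; lra]).
    lra.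
  - set (f := fun s : list bool => if hd true s then 0 else 1).
    exists (- (Dirichlet q L f / Varpi q L f)), f; split; [|reflexivity].
    exists (repeat true L), (repeat false L); repeat split;
      try (apply In_configs, repeat_length).
    destruct L as [|l]; [lia|]; unfold f; simpl; lra.
  - exists (- M); split.
    + intros f Hf.
      assert (- (Dirichlet q L f / Varpi q L f) <= M) by (apply HM1; exists f; auto). lra.
    + intros g' Hg'.
      assert (M <= - g'); [|lra].
      apply HM2; intros x (f & Hf & ->); specialize (Hg' f Hf); lra.
Qed.

Theorem mainTheorem2 :
  forall d : R, 0 < d ->
  exists alpha alpha' : R, 0 < alpha /\ 0 < alpha' /\
  forall (q : R) (L : nat), 0 < q -> q < 1 / 2 ->
    (1 <= L)%nat -> INR L <= d / q ->
    let n := Nat.log2_up L in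
    (exists g, is_spectral_gap q L g) /\
    forall g, is_spectral_gap q L g ->
      east_scale q n * Rpower q alpha <= / g /\
      / g <= east_scale q n * Rpower q (- alpha').
Proof.
  intros d Hd.
  destruct (Dirichlet_upper_bound d Hd) as (a & Ha & Hup).
  destruct (Dirichlet_lower_bound d Hd) as (a' & Ha' & Hlow).
  exists (INR a), (INR a'); split; [apply lt_0_INR; lia|]; split; [apply lt_0_INR; lia|].
  intros q L Hq Hq2 HL HLd n; split; [apply spectral_gap_exists; trivial; lra|].
  intros g [Hg1 Hg2].
  set (es := east_scale q n).
  assert (Hes : 0 < es) by now apply east_scale_pos.
  rewrite Rpower_Ropp, !Rpower_pow, <- pow_inv by exact Hq.
  assert (Hqa : 0 < q ^ a) by (apply pow_lt; lra).
  assert (Hqa' : 0 < (/ q) ^ a') by (apply pow_lt, Rinv_0_lt_compat; lra).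
  assert (Hs : 0 < es * (/ q) ^ a') by now apply Rmult_lt_0_compat.
  (* The Poincaré inequality bounds every quotient from below, and [g] is the largest such bound. *)
  assert (Hge : / (es * (/ q) ^ a') <= g).
  { apply Hg2; intros f Hf.
    assert (HV : 0 < Varpi q L f) by (apply Varpi_pos; trivial; lra).
    assert (H := Hlow q L Hq Hq2 HL HLd f); fold n es in H.
    apply Rmult_le_reg_r with (Varpi q L f); [exact HV|].
    apply Rmult_le_reg_l with (es * (/ q) ^ a'); [exact Hs|].
    rewrite <- Rmult_assoc, Rinv_r, Rmult_1_l by lra.
    replace (Dirichlet q L f / Varpi q L f * Varpi q L f) with (Dirichlet q L f) by (field; lra).
    exact H. }
  assert (Hg0 : 0 < g) by (apply Rlt_le_trans with (2 := Hge), Rinv_0_lt_compat, Hs).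
  split.
  - destruct (Hup q L Hq Hq2 HL HLd) as (f & Hf & HfD); fold n es in HfD.
    assert (Hle := Rle_trans _ _ _ (Hg1 f Hf) HfD).
    rewrite pow_inv, <- Rinv_mult in Hle.
    rewrite <- (Rinv_inv (es * q ^ a)), (Rmult_comm es).
    apply Rinv_le_contravar; assumption.
  - rewrite <- (Rinv_inv (es * (/ q) ^ a')).
    apply Rinv_le_contravar; [now apply Rinv_0_lt_compat | exact Hge].
Qed.
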